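(* There exist a complex Banach space $X$ and a Ritt operator $T\colon X\to X$ such that $T$ is polynomially bounded but, for every $\gamma\in\bigl(0,\frac{\pi}{2}\bigr)$, $T$ does not admit a bounded $\mathcal{H}^\infty(B_\gamma)$ functional calculus.
   Context: Let $\mathbb{D}=\{z\in\mathbb{C}:|z|<1\}$. Let $X$ be a complex Banach space and $T\colon X\to X$ a bounded linear operator, with resolvent $R(\lambda,T)=(\lambda-T)^{-1}$. $T$ is a Ritt operator if its spectrum is included in $\overline{\mathbb{D}}$ and the set $\{(\lambda-1)R(\lambda,T):|\lambda|>1\}$ is bounded in the operator norm. $T$ is polynomially bounded if there is a constant $K\geq 0$ such that $\|P(T)\|\leq K\sup\{|P(z)|:z\in\mathbb{D}\}$ for every complex polynomial $P$. For $\gamma\in\bigl(0,\frac{\pi}{2}\bigr)$, the Stolz domain $B_\gamma$ is the interior of the convex hull of the point $1$ and the disc $D(0,\sin\gamma)$. A Ritt operator $T$ has a bounded $\mathcal{H}^\infty(B_\gamma)$ functional calculus if there is a constant $K\geq 0$ such that $\|P(T)\|\leq K\sup\{|P(z)|:z\in B_\gamma\}$ for every complex polynomial $P$. *)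

(* Defs.v *)
From HB Require Import structures.
From mathcomp Require Export all_boot all_order all_algebra.
From mathcomp Require Export all_classical all_reals all_analysis.
From mathcomp Require Export complex.

Set Implicit Arguments.
Unset Strict Implicit.
Unset Printing Implicit Defensive.

Import Order.TTheory GRing.Theory Num.Theory.
Import numFieldNormedType.Exports.

Local Open Scope classical_set_scope.
Local Open Scope ring_scope.
Local Open Scope complex_scope.

(* In a normed space over R[i], `|x| is an element of R[i] whose imaginary
   part is 0; rnorm x is the same number, seen in R. *)
Definition rnorm (R : realType) (V : normedZmodType R[i]) (x : V) : R :=
  complex.Re `|x|.

Definition disc (R : realType) (r : R) : set R[i] := [set z | rnorm z < r].

Definition convex_hull (R : realType) (A : set (Rcomplex R)) :
    set (Rcomplex R) :=
  smallest (@convex_set R (Rcomplex R)) A.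

Definition stolz_domain (R : realType) (gamma : R) : set R[i] :=
  interior (convex_hull ([set 1] `|` disc (sin gamma))
            : set (R[i] : numFieldType)).

Section Operators.
Context (R : realType) (X : completeNormedModType R[i]).
Implicit Types (T S : {linear X -> X}) (P : {poly R[i]}) (lambda : R[i]).

Definition bounded_operator T : Prop :=
  exists M : R, forall x : X, rnorm (T x) <= M * rnorm x.

(* [sup] is real-valued, with value 0 on sets that are not bounded above; this
   is only used for bounded linear maps. *)
Definition opnorm (f : X -> X) : R :=
  sup [set rnorm (f x) | x in [set x : X | rnorm x <= 1]].

Definition is_resolvent T lambda S : Prop :=
  [/\ bounded_operator S,
      forall x : X, S (lambda *: x - T x) = x &
      forall x : X, lambda *: S x - T (S x) = x].

Definition spectrum T : set R[i] :=
  [set lambda | ~ exists S : {linear X -> X}, is_resolvent T lambda S].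

Definition ritt T : Prop :=
  [/\ bounded_operator T,
      spectrum T `<=` [set lambda | rnorm lambda <= 1] &
      exists C : R, forall lambda S, 1 < rnorm lambda ->
        is_resolvent T lambda S ->
        opnorm (fun x : X => (lambda - 1) *: S x) <= C].

Definition poly_op P T (x : X) : X :=
  \sum_(i < size P) P`_i *: iter i T x.

Definition bounded_calculus (Omega : set R[i]) T : Prop :=
  exists2 K : R, 0 <= K &
    forall P, opnorm (poly_op P T) <=
              K * sup [set rnorm P.[z] | z in Omega].

Definition polynomially_bounded T : Prop := bounded_calculus (disc 1) T.

Definition bounded_Hinfty_calculus (gamma : R) T : Prop :=
  bounded_calculus (stolz_domain gamma) T.

End Operators.

(* Main.v *)
(** The universal operator: let [X] be the dual of the algebra of rational
    functions with poles outside the closed disc, normed by the largest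
    submultiplicative norm for which the ball contains the polynomials bounded
    by 1 on the disc and the functions [(l - 1) / (50 (l - z))], [|l| > 1].
    Multiplication by [z] acts on [X]; by construction it is polynomially
    bounded and Ritt.  It remains to find functionals [phi] of bounded norm and
    polynomials [P], bounded on every sector at 1, with [phi P] unbounded.

    In the variable [v = (1 - z) / a] and its Cayley transform
    [s = (1 - v) / (1 + v)], the bump [n s^n (1 - s^2)^2] at scale [a] is
    bounded on sectors independently of [n], while its [n]-th Taylor
    coefficient in [s] is [n].  This coefficient is a functional of norm O(1)
    for the sup norm on [|s| <= rho], and of norm [2^n] for the sup norm on
    [|s| <= 1/2].  On the former disc [(l - 1) / (l - z)] is bounded unless
    [|l - 1|] is comparable to [a]; on the latter it is always bounded.
    Averaging the functional over [2^n] very sparse scales [a] gives [phi]: each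
    pole is harmful at one scale only, so the loss [2^n] is absorbed by the
    average, and a product of [k] pole factors gains [2^-k].  The polynomial [P]
    approximates the sum of the bumps at these scales. *)
From HB Require Import structures.
Require Import Defs.
From mathcomp Require Import ring lra.
From mathcomp Require Import cyclic separable cyclotomic.

Set Implicit Arguments.
Unset Strict Implicit.
Unset Printing Implicit Defensive.

Import Order.TTheory GRing.Theory Num.Theory.
Import numFieldNormedType.Exports.

Local Open Scope classical_set_scope.
Local Open Scope ring_scope.
Local Open Scope complex_scope.

(** * Real-valued norms and moduli *)

Section RealNorm.
Context (R : realType).

Lemma rnormE (V : normedZmodType R[i]) (x : V) : `|x| = (rnorm x)%:C.
Proof.
by have := normr_ge0 x; rewrite /rnorm lecE; case: `|x| => a b /= /andP[/eqP ->].
Qed.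

Section Zmod.
Context (V : normedZmodType R[i]).
Implicit Types x y : V.

Lemma rnorm_ge0 x : 0 <= rnorm x.
Proof. by rewrite -lecR -rnormE normr_ge0. Qed.

Lemma rnorm0 : rnorm (0 : V) = 0.
Proof. by apply: complexI; rewrite -rnormE normr0. Qed.

Lemma rnorm_eq0 x : (rnorm x == 0) = (x == 0).
Proof. by rewrite -[RHS]normr_eq0 rnormE -(inj_eq (@complexI R)). Qed.

Lemma rnormN x : rnorm (- x) = rnorm x.
Proof. by rewrite /rnorm normrN. Qed.

Lemma rnormB x y : rnorm (x - y) = rnorm (y - x).
Proof. by rewrite /rnorm distrC. Qed.

Lemma rnormD x y : rnorm (x + y) <= rnorm x + rnorm y.
Proof. by rewrite -lecR rmorphD /= -!rnormE ler_normD. Qed.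

Lemma rnorm_subr_ge x y : rnorm x - rnorm y <= rnorm (x - y).
Proof. by rewrite lerBlDr; have := rnormD (x - y) y; rewrite subrK. Qed.

Lemma rnorm_sum (I : Type) (s : seq I) (P : pred I) (F : I -> V) :
  rnorm (\sum_(i <- s | P i) F i) <= \sum_(i <- s | P i) rnorm (F i).
Proof.
elim/big_rec2: _ => [|i y x _ le_xy]; first by rewrite rnorm0.
by rewrite (le_trans (rnormD _ _))// lerD2l.
Qed.

End Zmod.

Lemma rnormZ (V : normedModType R[i]) (a : R[i]) (x : V) :
  rnorm (a *: x) = rnorm a * rnorm x.
Proof. by apply: complexI; rewrite rmorphM /= -!rnormE normrZ. Qed.

Implicit Types z w : R[i].

Lemma rnormM z w : rnorm (z * w) = rnorm z * rnorm w.
Proof. by apply: complexI; rewrite rmorphM /= -!rnormE normrM. Qed.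

Lemma rnorm1 : rnorm (1 : R[i]) = 1.
Proof. by apply: complexI; rewrite -rnormE normr1. Qed.

Lemma rnormX z n : rnorm (z ^+ n) = rnorm z ^+ n.
Proof. by apply: complexI; rewrite rmorphXn /= -!rnormE normrX. Qed.

Lemma rnormV z : rnorm z^-1 = (rnorm z)^-1.
Proof. by apply: complexI; rewrite fmorphV /= -!rnormE normfV. Qed.

Lemma rnormf_div z w : rnorm (z / w) = rnorm z / rnorm w.
Proof. by rewrite rnormM rnormV. Qed.

Lemma rnorm_real (x : R) : rnorm x%:C = `|x|.
Proof. by rewrite /rnorm normc_def /= expr0n addr0 sqrtr_sqr. Qed.

Lemma rnorm_nat n : rnorm (n%:R : R[i]) = n%:R.
Proof. by rewrite -(rmorph_nat (real_complex R)) rnorm_real ger0_norm. Qed.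

Lemma sqr_rnorm z : rnorm z ^+ 2 = complex.Re z ^+ 2 + complex.Im z ^+ 2.
Proof. by apply: complexI; rewrite add_Re2_Im2 rnormE rmorphXn. Qed.

Lemma abs_Re_le z : `|complex.Re z| <= rnorm z.
Proof.
by rewrite -(ler_pXn2r (n := 2)) ?nnegrE ?rnorm_ge0// real_normK ?num_real//
  sqr_rnorm lerDl sqr_ge0.
Qed.

Lemma abs_Im_le z : `|complex.Im z| <= rnorm z.
Proof.
by rewrite -(ler_pXn2r (n := 2)) ?nnegrE ?rnorm_ge0// real_normK ?num_real//
  sqr_rnorm lerDr sqr_ge0.
Qed.

Lemma rnorm_le_ReIm z : rnorm z <= `|complex.Re z| + `|complex.Im z|.
Proof.
rewrite -(ler_pXn2r (n := 2)) ?nnegrE ?rnorm_ge0// ?addr_ge0//.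
rewrite sqr_rnorm sqrrD !real_normK ?num_real// -addrA lerD2l lerDr.
by rewrite mulrn_wge0// mulr_ge0.
Qed.

End RealNorm.

(** * Weighted sequence spaces cut out by linear relations *)

Section WeightedAnnihilator.
Context (R : realType) (I : Type) (w : I -> {nonneg R}) (K : set (seq (R[i] * I))).
Implicit Types psi : I -> R[i].

Definition bounded_by psi (M : R) := forall i, rnorm (psi i) <= M * (w i)%:num.

Definition annihilator_pred psi : Prop :=
  (forall k, K k -> \sum_(p <- k) p.1 * psi p.2 = 0) /\
  exists2 M, 0 <= M & bounded_by psi M.

Definition annihilator : {pred I -> R[i]} := fun psi => `[< annihilator_pred psi >].

Lemma annihilator_submod_closed : submod_closed annihilator.
Proof.
split=> [|a f g /asboolP[Kf [M M0 fM]] /asboolP[Kg [N N0 gN]]]; apply/asboolP.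
  split=> [k _|]; first by rewrite big1// => p _; rewrite mulr0.
  by exists 0 => // i; rewrite mul0r rnorm0.
split=> [k kK|].
  under eq_bigr do rewrite mulrDr mulrCA.
  by rewrite big_split/= -mulr_sumr Kf// Kg// mulr0 addr0.
exists (rnorm a * M + N) => [|i]; first by rewrite addr_ge0// mulr_ge0// rnorm_ge0.
apply: (le_trans (rnormD _ _)); rewrite mulrDl -mulrA lerD ?gN//.
by rewrite rnormM ler_wpM2l ?rnorm_ge0.
Qed.

HB.instance Definition _ := GRing.isSubmodClosed.Build _ _ annihilator
  annihilator_submod_closed.

Record annih := Annih { annih_fun :> I -> R[i]; _ : annih_fun \in annihilator }.

HB.instance Definition _ := [isSub for annih_fun].
HB.instance Definition _ := [Choice of annih by <:].
HB.instance Definition _ := [SubChoice_isSubLmodule of annih by <:].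

Implicit Types x y : annih.

Lemma annihP x : annihilator_pred x.
Proof. exact/asboolP/(valP x). Qed.

Lemma annih_ext x y : (forall i, x i = y i) -> x = y.
Proof. by move=> xy; apply/val_inj/funext. Qed.

(** An infimum of bounds rather than a supremum of quotients, because weights may vanish. *)
Definition annih_norm x : R := inf [set M | 0 <= M /\ bounded_by x M].

Lemma annih_norm_has_inf x : has_inf [set M | 0 <= M /\ bounded_by x M].
Proof.
split; first by have [_ [M M0 xM]] := annihP x; exists M.
by exists 0 => M [].
Qed.

Lemma annih_norm_ge0 x : 0 <= annih_norm x.
Proof.
apply: lb_le_inf; first by case: (annih_norm_has_inf x).
by move=> M [].
Qed.

Lemma annih_norm_le x M : 0 <= M -> bounded_by x M -> annih_norm x <= M.
Proof. by move=> M0 xM; apply: ge_inf => //; exists 0 => N []. Qed.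

Lemma annih_norm_bound x : bounded_by x (annih_norm x).
Proof.
move=> i; have : 0 <= (w i)%:num by [].
rewrite le_eqVlt => /predU1P[w0|w0].
  (* Where the weight is 0, any admissible bound already forces the value 0. *)
  by have [_ [M _ /(_ i)]] := annihP x; rewrite -w0 !mulr0.
rewrite -ler_pdivrMr//; apply: lb_le_inf; first by case: (annih_norm_has_inf x).
by move=> M [_ /(_ i)]; rewrite -ler_pdivrMr.
Qed.

Definition annih_normC x : R[i] := (annih_norm x)%:C.

Lemma annih_normD x y : annih_normC (x + y) <= annih_normC x + annih_normC y.
Proof.
rewrite -rmorphD lecR; apply: annih_norm_le => [|i]; first by rewrite addr_ge0 ?annih_norm_ge0.
by apply: (le_trans (rnormD _ _)); rewrite mulrDl lerD// annih_norm_bound.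
Qed.

Lemma annih_norm_scale_le (a : R[i]) x :
  annih_norm (a *: x) <= rnorm a * annih_norm x.
Proof.
apply: annih_norm_le => [|i]; first by rewrite mulr_ge0 ?rnorm_ge0 ?annih_norm_ge0.
by rewrite /= rnormM -mulrA ler_wpM2l ?rnorm_ge0 ?annih_norm_bound.
Qed.

Lemma annih_normZ (a : R[i]) x : annih_normC (a *: x) = `|a| * annih_normC x.
Proof.
rewrite rnormE -rmorphM; congr (_%:C); apply/eqP; rewrite eq_le annih_norm_scale_le /=.
have [->|a0] := eqVneq a 0.
  by rewrite rnorm0 mul0r annih_norm_ge0.
rewrite -ler_pdivlMl ?lt_def ?rnorm_eq0 ?a0 ?rnorm_ge0// -rnormV.
by rewrite -{1}[x](scalerK a0) annih_norm_scale_le.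
Qed.

Lemma annih_norm0_eq0 x : annih_normC x = 0 -> x = 0.
Proof.
move=> /complexI x0; apply: annih_ext => i; apply/eqP.
by rewrite -rnorm_eq0 eq_le rnorm_ge0 andbT -(mul0r (w i)%:num) -x0 annih_norm_bound.
Qed.

HB.instance Definition _ := Lmodule_isNormed.Build R[i] annih
  annih_normD annih_normZ annih_norm0_eq0.

Lemma rnorm_annih x : rnorm x = annih_norm x.
Proof. by []. Qed.

Section Complete.
Variable F : set_system annih.
Hypotheses (FF : ProperFilter F) (cF : cauchy F).

Lemma annih_cauchy (e : R) : 0 < e -> exists x, F [set y | annih_norm (x - y) < e].
Proof.
move=> e0; have /cauchyP /(_ e%:C) [|x Fx] := cF; first by rewrite ltcR.
exists x; apply: filterS Fx => y; rewrite -ball_normE /ball_ /=.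
by rewrite rnormE ltcR rnorm_annih.
Qed.

(** Evaluation at [i] is Lipschitz with constant [w i], so the real and imaginary parts converge by
    completeness of the reals. The [+ 1] below keeps the divisor positive when [w i] is 0. *)
Lemma annih_pointwise_limit i :
  exists z : R[i], forall e : R, 0 < e -> F [set y : annih | rnorm (y i - z) < e].
Proof.
have cvg_part (p : R[i] -> R) : (forall u v, `|p u - p v| <= rnorm (u - v)) ->
    exists l, forall e : R, 0 < e -> F [set y : annih | `|l - p (y i)| < e].
  move=> p_lip; suff /R_complete /cvg_ex[l /cvgrPdist_lt Fl] :
    cauchy ((fun y : annih => p (y i)) @ F) by exists l.
  apply/cauchyP => e e0.
  have W0 : 0 < (w i)%:num + 1 by rewrite ltr_wpDl.
  have [|x Fx] := @annih_cauchy (e / ((w i)%:num + 1)); first by rewrite divr_gt0.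
  exists (p (x i)); change (F [set y : annih | ball (p (x i)) e (p (y i))]).
  apply: filterS Fx => y /= xy.
  rewrite -ball_normE /=; apply: (le_lt_trans (p_lip _ _)).
  apply: (le_lt_trans (annih_norm_bound (x - y) i)).
  apply: (@le_lt_trans _ _ (annih_norm (x - y) * ((w i)%:num + 1))).
    by rewrite ler_wpM2l ?annih_norm_ge0// lerDl.
  by rewrite -ltr_pdivlMr.
have [|a aP] := cvg_part (@complex.Re R).
  by move=> u v; rewrite -raddfB abs_Re_le.
have [|b bP] := cvg_part (@complex.Im R).
  by move=> u v; rewrite -raddfB abs_Im_le.
exists (a +i* b) => e e0; have e2 : 0 < e / 2 by rewrite divr_gt0.
apply: filterS2 (aP _ e2) (bP _ e2) => y /= ya yb.
rewrite rnormB [e]splitr (le_lt_trans (rnorm_le_ReIm _))//.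
by move: ya yb; case: (y i) => u v /= ya yb; rewrite ltrD.
Qed.

Lemma annih_complete : cvg F.
Proof.
have [l lP] := choice annih_pointwise_limit.
(* Relations are finite sums, so they pass to the pointwise limit. *)
have l_sum k (e : R) : 0 < e -> F [set y : annih |
    rnorm (\sum_(p <- k) p.1 * y p.2 - \sum_(p <- k) p.1 * l p.2) < e].
  elim: k e => [|[a i] k IHk] e e0.
    by apply: filterE => y /=; rewrite !big_nil subr0 rnorm0.
  have A0 : 0 < rnorm a + 1 by rewrite ltr_wpDl ?rnorm_ge0.
  apply: filterS2 (IHk (e / 2) _) (lP i (e / 2 / (rnorm a + 1)) _); last 2 first.
  - by rewrite divr_gt0.
  - by rewrite !divr_gt0.
  move=> y /= yk yi; rewrite !big_cons opprD addrACA -mulrBr.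
  rewrite [e]splitr (le_lt_trans (rnormD _ _))// ltrD// rnormM.
  apply: (@le_lt_trans _ _ ((rnorm a + 1) * rnorm (y i - l i))).
    by rewrite ler_wpM2r ?rnorm_ge0// lerDl.
  by rewrite mulrC -ltr_pdivlMr.
(* Bounds uniform in [i] survive the pointwise limit; this gives both membership of [l] and
   convergence in norm. *)
have l_near x (e : R) : F [set y | annih_norm (x - y) < e] ->
    forall i, rnorm (x i - l i) <= e * (w i)%:num.
  move=> Fx i; apply/ler_addgt0Pr => d d0.
  have [y [/= xy yl]] := filter_ex (filterI Fx (lP i d d0)).
  rewrite -[x i](subrK (y i)) -addrA (le_trans (rnormD _ _))// lerD ?(ltW yl)//.
  by rewrite (le_trans (annih_norm_bound (x - y) i))// ler_wpM2r// ltW.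
have l_in : l \in annihilator.
  apply/asboolP; split=> [k kK|].
    apply/eqP; rewrite -rnorm_eq0 eq_le rnorm_ge0 andbT.
    apply/ler_addgt0Pr => e e0; rewrite add0r.
    have [y /=] := filter_ex (l_sum k e e0).
    have [/(_ k kK) -> _] := annihP y.
    by rewrite sub0r rnormN => /ltW.
  have [x Fx] := annih_cauchy ltr01.
  exists (annih_norm x + 1) => [|i]; first by rewrite addr_ge0 ?annih_norm_ge0.
  rewrite -[l i](subrK (x i)) addrC (le_trans (rnormD _ _))// mulrDl.
  by rewrite lerD ?annih_norm_bound// rnormB l_near.
apply/cvg_ex; exists (Annih l_in); apply/cvgrPdist_lt => /= e' e'0.
have [e e0 ->] : exists2 e : R, 0 < e & e' = e%:C.
  move: e'0; rewrite ltcE; case: e' => a b /= /andP[/eqP -> a0].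
  by exists a.
have e2 : 0 < e / 2 by rewrite divr_gt0.
(* Two errors of [e / 4] give the non-strict bound [e / 2], hence the strict bound [e]. *)
have e4 : 0 < e / 2 / 2 by rewrite !divr_gt0.
have [x Fx] := annih_cauchy e4; near=> y.
rewrite rnormE ltcR rnorm_annih (@le_lt_trans _ _ (e / 2))//; last first.
  by rewrite ltr_pdivrMr// mulr_natr mulr2n ltrDl.
apply: annih_norm_le => [|i]; first exact: ltW.
change (rnorm (l i - y i) <= e / 2 * (w i)%:num).
rewrite -[l i](subrK (x i)) -addrA (le_trans (rnormD _ _))//.
rewrite [e / 2]splitr mulrDl lerD//; first by rewrite rnormB l_near.
apply: (le_trans (annih_norm_bound (x - y) i)); rewrite ler_wpM2r// ltW//.
by near: y; exact: Fx.
Unshelve. all: by end_near. Qed.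

End Complete.

HB.instance Definition _ := Uniform_isComplete.Build annih annih_complete.

End WeightedAnnihilator.

(** * The universal operator *)

Section OperatorNorm.
Context (R : realType) (X : completeNormedModType R[i]).

Lemma opnorm_le (f : X -> X) M :
  0 <= M -> (forall x, rnorm (f x) <= M * rnorm x) -> opnorm f <= M.
Proof.
move=> M0 fM; apply: ge_sup.
  by exists (rnorm (f 0)), 0 => //=; rewrite rnorm0.
by move=> _ [x /= x1 <-]; rewrite (le_trans (fM x))// ler_piMr.
Qed.

Lemma le_opnorm (f : X -> X) M x :
  0 <= M -> (forall x, rnorm (f x) <= M * rnorm x) -> rnorm x <= 1 ->
  rnorm (f x) <= opnorm f.
Proof.
move=> M0 fM x1; apply: sup_upper_bound; last by exists x.
split; first by exists (rnorm (f x)), x.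
by exists M => _ [y /= y1 <-]; rewrite (le_trans (fM y))// ler_piMr.
Qed.

End OperatorNorm.

Section DiscSup.
Context (R : realType).
Implicit Types f g : {poly R[i]}.

Definition disc_sup f : R := sup [set rnorm f.[z] | z in disc 1].

Lemma rnorm_horner_le f z (r : R) : rnorm z <= r ->
  rnorm f.[z] <= \sum_(i < size f) rnorm f`_i * r ^+ i.
Proof.
move=> zr; rewrite horner_coef (le_trans (rnorm_sum _ _ _))// ler_sum// => i _.
by rewrite rnormM rnormX ler_wpM2l ?rnorm_ge0// lerXn2r// nnegrE ?rnorm_ge0//
  (le_trans (rnorm_ge0 z)).
Qed.

Lemma has_sup_disc f : has_sup [set rnorm f.[z] | z in disc 1].
Proof.
split; first by exists (rnorm f.[0]), 0 => //; rewrite /disc/= rnorm0.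
exists (\sum_(i < size f) rnorm f`_i * 1 ^+ i) => _ [z /ltW z1 <-].
exact: rnorm_horner_le.
Qed.

Lemma le_disc_sup f z : rnorm z < 1 -> rnorm f.[z] <= disc_sup f.
Proof. by move=> z1; apply: (sup_upper_bound (has_sup_disc f)); exists z. Qed.

Lemma disc_sup_le f M : (forall z, rnorm z < 1 -> rnorm f.[z] <= M) -> disc_sup f <= M.
Proof.
by move=> fM; apply: ge_sup; [case: (has_sup_disc f) | move=> _ [z z1 <-]; exact: fM].
Qed.

Lemma disc_sup_ge0 f : 0 <= disc_sup f.
Proof. by rewrite (le_trans (rnorm_ge0 f.[0]))// le_disc_sup// rnorm0. Qed.

Lemma disc_supM f g : disc_sup (f * g) <= disc_sup f * disc_sup g.
Proof.
by apply: disc_sup_le => z z1; rewrite hornerM rnormM ler_pM ?rnorm_ge0 ?le_disc_sup.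
Qed.

Lemma disc_supX : disc_sup 'X <= 1.
Proof. by apply: disc_sup_le => z /ltW; rewrite hornerX. Qed.

Lemma disc_sup1 : disc_sup 1 <= 1.
Proof. by apply: disc_sup_le => z _; rewrite hornerC rnorm1. Qed.

End DiscSup.

Section UniversalOperator.
Context (R : realType).

Definition pole := {l : R[i] | 1 < rnorm l}.

(* [(f, L)] stands for the rational function
   [f(z) * \prod_(l <- L) pole_factor l / (l - z)]; the relations below are the
   linear ones between these functions. *)
Definition symbol := ({poly R[i]} * seq pole)%type.

(** The weight ignores the list of poles: each quotient [pole_factor l / (l - z)] is thereby
    declared to have norm at most 1, with any multiplicity. *)
Definition weight (i : symbol) : {nonneg R} := NngNum (disc_sup_ge0 i.1).

(* [|l - 1| <= 25 |l - z|] holds at all the nodes [z] that matter below, so that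
   the quotients [pole_factor l / (l - z)] have modulus at most 1/2 there. *)
Definition pole_factor (l : pole) : R[i] := (50^-1)%:C * (val l - 1).

(** Cancellation is allowed at every position of the list because [divX] below puts its pole at the
    head, in front of those already present. *)
Definition relations : set (seq (R[i] * symbol)) :=
  [set k | (exists a f g L, k = [:: (a, (f, L)); (1, (g, L)); (-1, (a *: f + g, L))])
    \/ (exists f L1 l L2, k = [:: (1, (((val l)%:P - 'X) * f, L1 ++ l :: L2));
                                  (- pole_factor l, (f, L1 ++ L2))])].

Definition functional : Type := annih weight relations.
HB.instance Definition _ := CompleteNormedModule.on functional.

Implicit Types (psi : functional) (f g : {poly R[i]}) (L : seq pole) (l : pole).

Definition compatible (psi : symbol -> R[i]) : Prop :=
  (forall a f g L, psi (a *: f + g, L) = a * psi (f, L) + psi (g, L)) /\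
  (forall f L1 l L2, psi (((val l)%:P - 'X) * f, L1 ++ l :: L2)
    = pole_factor l * psi (f, L1 ++ L2)).

Lemma compatibleP (psi : symbol -> R[i]) :
  compatible psi <-> forall k, relations k -> \sum_(p <- k) p.1 * psi p.2 = 0.
Proof.
split=> [[lin res] k|kP].
  case=> [[a [f [g [L ->]]]]|[f [L1 [l [L2 ->]]]]]; rewrite !big_cons big_nil/=.
    by rewrite lin; ring.
  by rewrite res; ring.
split=> [a f g L|f L1 l L2].
  have /kP : relations [:: (a, (f, L)); (1, (g, L)); (-1, (a *: f + g, L))].
    by left; exists a, f, g, L.
  rewrite !big_cons big_nil/= mul1r addr0 mulN1r addrA => /subr0_eq.
  by move=> ->.
have /kP : relations [:: (1, (((val l)%:P - 'X) * f, L1 ++ l :: L2));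
                         (- pole_factor l, (f, L1 ++ L2))].
  by right; exists f, L1, l, L2.
by rewrite !big_cons big_nil/= mul1r addr0 mulNr => /subr0_eq.
Qed.

Lemma functional_compatible psi : compatible psi.
Proof. by apply/compatibleP; case: (annihP psi). Qed.

Lemma functional0 psi L : psi (0, L) = 0.
Proof.
have [lin _] := functional_compatible psi; have := lin (-1) 0 0 L.
by rewrite scaler0 addr0 mulN1r addNr.
Qed.

Lemma functionalD psi f g L : psi (f + g, L) = psi (f, L) + psi (g, L).
Proof.
by have [lin _] := functional_compatible psi; rewrite -[f]scale1r lin mul1r scale1r.
Qed.

Lemma functionalZ psi a f L : psi (a *: f, L) = a * psi (f, L).
Proof.
have [lin _] := functional_compatible psi.
by rewrite -[a *: f]addr0 lin functional0 addr0.
Qed.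

Lemma functional_sum psi (n : nat) (F : 'I_n -> {poly R[i]}) L :
  psi (\sum_(i < n) F i, L) = \sum_(i < n) psi (F i, L).
Proof.
elim/big_ind2: _ => [|_ f _ g <- <-|//]; first exact: functional0.
exact: functionalD.
Qed.

Lemma functional_pole psi f L l : val l * psi (f, l :: L) - psi ('X * f, l :: L)
  = pole_factor l * psi (f, L).
Proof.
have [_ res] := functional_compatible psi; have /= <- := res f [::] l L.
by rewrite mulrBl mul_polyC -[- ('X * f)]scaleN1r functionalD !functionalZ mulN1r.
Qed.

Lemma functional_bound psi f L : rnorm (psi (f, L)) <= rnorm psi * disc_sup f.
Proof. exact: (annih_norm_bound psi (f, L)). Qed.

Lemma functional_norm_le psi M : 0 <= M ->
  (forall f L, rnorm (psi (f, L)) <= M * disc_sup f) -> rnorm psi <= M.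
Proof. by move=> M0 psiM; apply: annih_norm_le => // -[f L]; exact: psiM. Qed.

Lemma mem_functional (psi : symbol -> R[i]) M : 0 <= M -> compatible psi ->
  (forall f L, rnorm (psi (f, L)) <= M * disc_sup f) ->
  psi \in annihilator weight relations.
Proof.
move=> M0 /compatibleP psiP psiM; apply/asboolP; split=> //.
by exists M => // -[f L]; exact: psiM.
Qed.

(** The adjoint of multiplication by z respects both kinds of relations and does not increase norms,
    since |z| < 1 on the disc. *)
Lemma mulX_mem psi :
  (fun i : symbol => psi ('X * i.1, i.2)) \in annihilator weight relations.
Proof.
have [lin res] := functional_compatible psi.
apply: (@mem_functional _ (rnorm psi)); first exact: rnorm_ge0.
  split=> /= [a f g L|f L1 l L2]; first by rewrite mulrDr -scalerAr lin.
  by rewrite mulrCA res.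
move=> f L; apply: (le_trans (functional_bound psi ('X * f) L)); rewrite ler_wpM2l ?rnorm_ge0//.
by rewrite (le_trans (disc_supM _ _))// ler_piMl ?disc_sup_ge0// disc_supX.
Qed.

Definition mulX psi : functional := Annih (mulX_mem psi).

Lemma mulX_is_linear : linear mulX.
Proof. by move=> a psi psi'; apply: annih_ext. Qed.

HB.instance Definition _ :=
  GRing.isLinear.Build R[i] functional functional *:%R mulX mulX_is_linear.

Lemma mulX_bound psi : rnorm (mulX psi) <= 1 * rnorm psi.
Proof.
rewrite mul1r; apply: functional_norm_le => [|f L]; first exact: rnorm_ge0.
apply: (le_trans (functional_bound psi ('X * f) L)); rewrite ler_wpM2l ?rnorm_ge0//.
by rewrite (le_trans (disc_supM _ _))// ler_piMl ?disc_sup_ge0// disc_supX.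
Qed.

(** Adjoining [l] to the list multiplies the rational function by [pole_factor l / (l - z)] without
    changing its weight. Dividing by [pole_factor l] leaves the adjoint of multiplication by 1 / (l
    - z), of norm at most 50 / |l - 1|. *)
Lemma divX_mem l psi :
  (fun i : symbol => (pole_factor l)^-1 * psi (i.1, l :: i.2))
    \in annihilator weight relations.
Proof.
have [lin res] := functional_compatible psi.
apply: (@mem_functional _ (rnorm (pole_factor l)^-1 * rnorm psi)).
- by rewrite mulr_ge0 ?rnorm_ge0.
- split=> /= [a f g L|f L1 l' L2]; first by rewrite lin mulrDr mulrCA.
  by rewrite -cat_cons res mulrCA.
move=> f L; rewrite rnormM -mulrA ler_wpM2l ?rnorm_ge0//.
exact: functional_bound.
Qed.

Definition divX l psi : functional := Annih (divX_mem l psi).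

Lemma divX_is_linear l : linear (divX l).
Proof.
move=> a psi psi'; apply: annih_ext => -[f L] /=.
by rewrite -/(divX l psi) -[RHS]/(a * _ + _) /= mulrDr mulrCA.
Qed.

HB.instance Definition _ l :=
  GRing.isLinear.Build R[i] functional functional *:%R (divX l) (divX_is_linear l).

Lemma divX_bound l psi :
  rnorm (divX l psi) <= rnorm (pole_factor l)^-1 * rnorm psi.
Proof.
apply: functional_norm_le => [|f L]; first by rewrite mulr_ge0 ?rnorm_ge0.
by rewrite rnormM -mulrA ler_wpM2l ?rnorm_ge0// functional_bound.
Qed.

Lemma pole_factor_neq0 l : pole_factor l != 0.
Proof.
rewrite /pole_factor mulf_neq0//.
  by rewrite (inj_eq (@complexI R) _ 0) invr_neq0// pnatr_eq0.
by rewrite subr_eq0; apply: contraTneq (valP l) => ->; rewrite rnorm1 ltxx.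
Qed.

Lemma divX_resolvent l : is_resolvent mulX (val l) (divX l).
Proof.
split=> [|psi|psi].
- by exists (rnorm (pole_factor l)^-1) => psi; exact: divX_bound.
- apply: annih_ext => -[f L].
  rewrite -[LHS]/((pole_factor l)^-1 *
     (val l * psi (f, l :: L) - psi ('X * f, l :: L))).
  by rewrite functional_pole mulKf ?pole_factor_neq0.
apply: annih_ext => -[f L].
rewrite -[LHS]/(val l * ((pole_factor l)^-1 * psi (f, l :: L)) -
   (pole_factor l)^-1 * psi ('X * f, l :: L)).
by rewrite mulrCA -mulrBr functional_pole mulKf ?pole_factor_neq0.
Qed.

Lemma iter_mulX i psi f L : iter i mulX psi (f, L) = psi ('X^i * f, L).
Proof.
elim: i f => [|i IHi] f; first by rewrite expr0 mul1r.
by rewrite iterS -[LHS]/(iter i mulX psi ('X * f, L)) IHi mulrA -exprSr.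
Qed.

Lemma annih_sum_apply n (x : 'I_n -> functional) i :
  (\sum_(k < n) x k) i = \sum_(k < n) x k i.
Proof. by elim/big_ind2: _ => // _ u _ v <- <-. Qed.

Lemma mulX_poly_op P psi f L : poly_op P mulX psi (f, L) = psi (P * f, L).
Proof.
rewrite /poly_op annih_sum_apply.
rewrite -[RHS]/(psi (P * f, L)) (_ : P * f = \sum_(k < size P) P`_k *: 'X^k * f).
  rewrite functional_sum.
  by apply: eq_bigr => k _; rewrite -scalerAl functionalZ -iter_mulX.
by rewrite -mulr_suml -poly_def coefK.
Qed.

Lemma mulX_poly_op_bound P psi :
  rnorm (poly_op P mulX psi) <= disc_sup P * rnorm psi.
Proof.
apply: functional_norm_le => [|f L]; first by rewrite mulr_ge0 ?rnorm_ge0 ?disc_sup_ge0.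
rewrite mulX_poly_op (le_trans (functional_bound _ _ _))// [disc_sup P * _]mulrC -mulrA.
by rewrite ler_wpM2l ?rnorm_ge0// disc_supM.
Qed.

Lemma mulX_ritt : ritt mulX.
Proof.
split; first by exists 1; exact: mulX_bound.
  move=> l /= nl; rewrite leNgt; apply/negP => l1; apply: nl.
  by exists (divX (exist _ l l1)); exact: (divX_resolvent (exist _ l l1)).
exists 50 => l S l1 [_ SK _]; pose p : pole := exist _ l l1.
have [_ _ pK] := divX_resolvent p.
(* Any resolvent [S] agrees with [divX p], as a left inverse does with a right inverse. The constant
   50 undoes the [50^-1] of [pole_factor]. *)
apply: opnorm_le => // psi; rewrite -[psi in S psi](pK psi) SK rnormZ.
apply: (le_trans (ler_wpM2l (rnorm_ge0 _) (divX_bound p psi))).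
rewrite mulrA ler_wpM2r ?rnorm_ge0//.
rewrite rnormV rnormM rnorm_real ger0_norm ?invr_ge0// invfM invrK mulrCA.
rewrite ger_pMr// mulfV// rnorm_eq0.
by have := pole_factor_neq0 p; rewrite mulf_eq0 negb_or => /andP[].
Qed.

Lemma mulX_polynomially_bounded : polynomially_bounded mulX.
Proof.
exists 1 => // P; rewrite mul1r -/(disc_sup P).
by apply: opnorm_le => [|psi]; rewrite ?disc_sup_ge0 ?mulX_poly_op_bound.
Qed.

(** Apply the operator to [psi / M], which lies in the unit ball, and evaluate at the symbol [(1,
    [::])] of weight at most 1: the result is the value of [psi / M] at [P]. *)
Lemma le_mulX_opnorm P psi M : 0 < M ->
  (forall f L, rnorm (psi (f, L)) <= M * disc_sup f) ->
  rnorm (psi (P, [::])) <= M * opnorm (poly_op P mulX).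
Proof.
move=> M0 psiM; have psi_le : rnorm psi <= M by apply: functional_norm_le; rewrite // ltW.
pose phi := (M^-1)%:C *: psi.
have phi1 : rnorm phi <= 1.
  by rewrite rnormZ rnorm_real gtr0_norm ?invr_gt0// ler_pdivrMl// mulr1.
have := le_opnorm (disc_sup_ge0 P) (mulX_poly_op_bound P) phi1.
rewrite -ler_pdivrMl//; apply: le_trans.
apply: (le_trans _ (le_trans (functional_bound (poly_op P mulX phi) 1 [::]) _)); last first.
  by rewrite ler_piMr ?rnorm_ge0 ?disc_sup1.
by rewrite mulX_poly_op mulr1 -[phi _]/((M^-1)%:C * _) rnormM rnorm_real gtr0_norm ?invr_gt0.
Qed.

End UniversalOperator.

(** * Uniform approximation by polynomials on a disc *)

Section PolynomialApproximation.
Context (R : realType) (r : R).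
Implicit Types g h : R[i] -> R[i].

(** This plays the part of analyticity on the closed disc of radius [r]: coefficient estimates are
    proved for polynomials and extended to uniform limits. *)
Definition poly_approximable g := forall e : R, 0 < e ->
  exists p : {poly R[i]}, forall z, rnorm z <= r -> rnorm (g z - p.[z]) <= e.

Lemma poly_approximable_horner (p : {poly R[i]}) : poly_approximable (fun z => p.[z]).
Proof. by move=> e e0; exists p => z _; rewrite subrr rnorm0 ltW. Qed.

Lemma poly_approximable_ext g h : (forall z, rnorm z <= r -> g z = h z) ->
  poly_approximable g -> poly_approximable h.
Proof. by move=> gh + e e0 => /(_ e e0)[p pP]; exists p => z zr; rewrite -gh ?pP. Qed.

Lemma poly_approximable_cst a : poly_approximable (fun=> a).
Proof.
by apply: poly_approximable_ext (poly_approximable_horner a%:P) => z _; rewrite hornerC.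
Qed.

Lemma poly_approximableD g h : poly_approximable g -> poly_approximable h ->
  poly_approximable (fun z => g z + h z).
Proof.
move=> ga ha e e0; have e2 : 0 < e / 2 by rewrite divr_gt0.
have [[p pP] [q qP]] := (ga _ e2, ha _ e2).
exists (p + q) => z zr; rewrite hornerD opprD addrACA [e]splitr.
by rewrite (le_trans (rnormD _ _))// lerD ?pP ?qP.
Qed.

Lemma poly_approximable_bounded g : poly_approximable g ->
  exists2 B, 0 < B & forall z, rnorm z <= r -> rnorm (g z) <= B.
Proof.
move=> /(_ 1 ltr01)[p pP].
(* For negative [r] the disc is empty. *)
have [r0|r0] := leP 0 r; last first.
  by exists 1 => // z zr; have := le_lt_trans zr r0; rewrite ltNge rnorm_ge0.
pose S := \sum_(i < size p) rnorm p`_i * r ^+ i.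
have S0 : 0 <= S by rewrite sumr_ge0// => i _; rewrite mulr_ge0 ?rnorm_ge0 ?exprn_ge0.
exists (1 + S) => [|z zr]; first by rewrite ltr_wpDr.
rewrite -(subrK p.[z] (g z)) (le_trans (rnormD _ _))// lerD ?pP//.
exact: rnorm_horner_le.
Qed.

Lemma poly_approximableM g h : poly_approximable g -> poly_approximable h ->
  poly_approximable (fun z => g z * h z).
Proof.
move=> ga ha e e0; have [H H0 hH] := poly_approximable_bounded ha.
have [|p pP] := ga (e / 2 / H); first by rewrite !divr_gt0.
(* The accuracy required of [q] depends on the size of [p], so [p] is chosen first. *)
have [P P0 pB] := poly_approximable_bounded (poly_approximable_horner p).
have [|q qP] := ha (e / 2 / P); first by rewrite !divr_gt0.
exists (p * q) => z zr; rewrite hornerM.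
have -> : g z * h z - p.[z] * q.[z] = (g z - p.[z]) * h z + p.[z] * (h z - q.[z]) by ring.
rewrite [e]splitr (le_trans (rnormD _ _))// !rnormM lerD//.
  by rewrite -[e / 2](divfK (lt0r_neq0 H0)) ler_pM ?rnorm_ge0 ?pP ?hH.
by rewrite -[e / 2](divfK (lt0r_neq0 P0)) mulrC ler_pM ?rnorm_ge0 ?qP ?pB.
Qed.

Lemma poly_approximableX g n : poly_approximable g ->
  poly_approximable (fun z => g z ^+ n).
Proof.
move=> ga; elim: n => [|n IHn]; first exact: poly_approximable_cst.
by apply: poly_approximable_ext (poly_approximableM ga IHn) => z _; rewrite exprS.
Qed.

Lemma poly_approximable_sum (I : Type) (s : seq I) (F : I -> R[i] -> R[i]) :
  (forall i, poly_approximable (F i)) ->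
  poly_approximable (fun z => \sum_(i <- s) F i z).
Proof.
move=> Fa; elim: s => [|i s IHs].
  by apply: poly_approximable_ext (poly_approximable_cst 0) => z _; rewrite big_nil.
by apply: poly_approximable_ext (poly_approximableD (Fa i) IHs) => z _; rewrite big_cons.
Qed.

Lemma poly_approximable_prod (I : Type) (s : seq I) (F : I -> R[i] -> R[i]) :
  (forall i, poly_approximable (F i)) ->
  poly_approximable (fun z => \prod_(i <- s) F i z).
Proof.
move=> Fa; elim: s => [|i s IHs].
  by apply: poly_approximable_ext (poly_approximable_cst 1) => z _; rewrite big_nil.
by apply: poly_approximable_ext (poly_approximableM (Fa i) IHs) => z _; rewrite big_cons.
Qed.

Lemma poly_approximable_comp (p : {poly R[i]}) g : poly_approximable g ->
  poly_approximable (fun z => p.[g z]).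
Proof.
move=> ga.
have : poly_approximable (fun z => \sum_(i < size p) p`_i * g z ^+ i).
  apply: poly_approximable_sum => i.
  by apply: poly_approximableM (poly_approximableX _ ga); exact: poly_approximable_cst.
by apply: poly_approximable_ext => z _; rewrite horner_coef.
Qed.

(** Truncate the geometric series in z / a: the remainder is (z / a)^N / (a - z), and |a - z| is at
    least |a| - r. *)
Lemma poly_approximable_pole a : 0 <= r -> r < rnorm a ->
  poly_approximable (fun z => (a - z)^-1).
Proof.
move=> r0 ra e e0; have a0 : 0 < rnorm a := le_lt_trans r0 ra.
have an0 : a != 0 by rewrite -rnorm_eq0 gt_eqF.
pose t := r / rnorm a.
have t0 : 0 <= t by rewrite divr_ge0 ?rnorm_ge0.
have t1 : t < 1 by rewrite ltr_pdivrMr// mul1r.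
have d0 : 0 < e * (rnorm a - r) by rewrite mulr_gt0 ?subr_gt0.
have /cvgrPdist_lt/(_ _ d0)[N _ /(_ N (leqnn N))] : t ^+ n @[n --> \oo] --> (0 : R).
  by apply: cvg_expr; rewrite ger0_norm.
rewrite /= sub0r normrN ger0_norm ?exprn_ge0// => tN.
exists (\sum_(k < N) (a ^- k.+1) *: 'X^k) => z zr.
have az : 0 < rnorm (a - z).
  by rewrite (lt_le_trans _ (rnorm_subr_ge _ _))// subr_gt0 (le_lt_trans zr).
have azn0 : a - z != 0 by rewrite -rnorm_eq0 gt_eqF.
have -> : (a - z)^-1 - (\sum_(k < N) (a ^- k.+1) *: 'X^k).[z] = (z / a) ^+ N / (a - z).
  apply: (mulIf azn0); rewrite mulrBl mulVf// divfK//.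
  have -> : (\sum_(k < N) (a ^- k.+1) *: 'X^k).[z] * (a - z)
      = (1 - z / a) * \sum_(k < N) (z / a) ^+ k.
    rewrite horner_sum !mulr_suml mulr_sumr; apply: eq_bigr => k _.
    rewrite hornerZ hornerXn expr_div_n exprS invfM.
    by rewrite -[a - z](mulfK an0) mulrBl; field; rewrite an0 expf_neq0.
  rewrite -[1 - z / a]opprB -[- (z / a - 1)]mulN1r -mulrA -subrX1.
  by ring.
rewrite rnormf_div rnormX rnormf_div ler_pdivrMr//.
apply: (@le_trans _ _ (t ^+ N)).
  rewrite lerXn2r ?nnegrE ?divr_ge0 ?rnorm_ge0// ler_wpM2r// ?invr_ge0 ?rnorm_ge0//.
rewrite (le_trans (ltW tN))// ler_wpM2l ?(ltW e0)//.
by rewrite (le_trans _ (rnorm_subr_ge _ _))// lerB.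
Qed.

Lemma poly_approximable_inv_affine a b : 0 <= r ->
  (forall z, rnorm z <= r -> a + b * z != 0) ->
  poly_approximable (fun z => (a + b * z)^-1).
Proof.
move=> r0 ab0; have [->|b0] := eqVneq b 0.
  apply: poly_approximable_ext (poly_approximable_cst a^-1) => z _.
  by rewrite mul0r addr0.
have ra : r < rnorm (- a / b).
  rewrite ltNge; apply/negP => /ab0/negP; apply.
  by rewrite mulrC divfK// subrr.
have := poly_approximableM (poly_approximable_cst (- b^-1)) (poly_approximable_pole r0 ra).
apply: poly_approximable_ext => z zr; have abz := ab0 z zr.
have abz' : - a / b - z != 0.
  apply: contraNneq abz => /subr0_eq <-.
  by rewrite mulrC divfK// subrr.
apply: (mulfI abz); rewrite divff//; apply: (mulIf abz').
rewrite -!mulrA mulVf// mulr1 mul1r; field.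
by rewrite b0.
Qed.

End PolynomialApproximation.

(** * Taylor coefficients through roots of unity *)

Section RootAverage.
Context (R : realType).
Implicit Types (g h : R[i] -> R[i]) (p : {poly R[i]}).

(** X^m - 1 splits and is separable, and a set of m distinct m-th roots of unity contains a
    primitive one. *)
Lemma complex_prim_root_exists m : (0 < m)%N -> exists w : R[i], m.-primitive_root w.
Proof.
move=> m0; have [s Dp] := closed_field_poly_normal ('X^m - 1 : {poly R[i]}).
rewrite (monicP _) ?monicXnsubC // scale1r in Dp.
have s1 : all m.-unity_root s by apply/allP=> z; rewrite -root_prod_XsubC -Dp.
have sz_s : (m < (size s).+1)%N.
  by rewrite -(size_prod_XsubC s id) -Dp size_XnsubC.
have [|z] := hasP (has_prim_root m0 s1 _ sz_s); last by exists z.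
by rewrite -separable_prod_XsubC -Dp separable_Xn_sub_1 // pnatr_eq0 -lt0n.
Qed.

(** A discrete Cauchy integral on the circle of radius |s|: it yields s^n times the n-th Taylor
    coefficient, up to aliasing among exponents congruent modulo [m]. *)
Definition root_average (w : R[i]) m (s : R[i]) n g : R[i] :=
  m%:R^-1 * \sum_(k < m) g (s * w ^+ k) / (w ^+ k) ^+ n.

Context (w : R[i]) (m : nat) (w_prim : m.-primitive_root w).

Lemma rnorm_prim_root k : rnorm (w ^+ k) = 1.
Proof.
have m0 := prim_order_gt0 w_prim.
have := prim_expr_order w_prim => /(congr1 (@rnorm _ _)).
by rewrite rnorm1 !rnormX => /eqP; rewrite pexpr_eq1 ?rnorm_ge0// => /eqP ->; rewrite expr1n.
Qed.

Lemma root_average_le g s n B : (forall z, rnorm z = rnorm s -> rnorm (g z) <= B) ->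
  rnorm (root_average w m s n g) <= B.
Proof.
move=> gB; have m0 := prim_order_gt0 w_prim.
rewrite rnormM rnormV rnorm_nat mulrC ler_pdivrMr ?ltr0n//.
apply: (le_trans (rnorm_sum _ _ _)).
rewrite mulr_natr -[in leRHS](card_ord m) -sumr_const ler_sum// => k _.
rewrite rnormf_div rnormX rnorm_prim_root expr1n divr1 gB//.
by rewrite rnormM rnorm_prim_root mulr1.
Qed.

(** Orthogonality of characters: if the ratio w^j / w^n is not 1, it is an m-th root of unity whose
    geometric sum vanishes. *)
Lemma sum_prim_root j n :
  \sum_(k < m) (w ^+ k) ^+ j / (w ^+ k) ^+ n = (w ^+ j == w ^+ n)%:R * m%:R.
Proof.
have w0 i : w ^+ i != 0 by rewrite -rnorm_eq0 rnorm_prim_root oner_eq0.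
have x1 : (w ^+ j / w ^+ n) ^+ m = 1.
  by rewrite expr_div_n -!exprM !(mulnC _ m) !exprM (prim_expr_order w_prim) !expr1n divr1.
under eq_bigr do rewrite -!exprM !(mulnC _ j) !(mulnC _ n) !exprM -expr_div_n.
case: eqP => [->|/eqP jn].
  under eq_bigr do rewrite divff// expr1n.
  by rewrite sumr_const card_ord mul1r.
rewrite mul0r; apply: (mulfI (_ : w ^+ j / w ^+ n - 1 != 0)).
  by apply: contraNneq jn => /subr0_eq /(congr1 ( *%R^~ (w ^+ n))); rewrite divfK// mul1r => ->.
by rewrite -subrX1 x1 subrr mulr0.
Qed.

Lemma root_average_horner p s n : root_average w m s n (fun z => p.[z])
  = \sum_(j < size p | w ^+ j == w ^+ n) p`_j * s ^+ j.
Proof.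
have m0 : m%:R != 0 :> R[i] by rewrite pnatr_eq0 -lt0n (prim_order_gt0 w_prim).
apply: (mulfI m0); rewrite mulVKf//.
under eq_bigr do rewrite horner_coef mulr_suml.
rewrite exchange_big/= mulr_sumr [RHS]big_mkcond; apply: eq_bigr => j _ /=.
under eq_bigr do rewrite exprMn mulrA -[_ / _]mulrA.
rewrite -mulr_sumr sum_prim_root.
by case: ifP => _; rewrite ?mul1r ?mul0r ?mulr0// mulrC.
Qed.

Lemma root_averageB g h s n : root_average w m s n (fun z => g z - h z) =
  root_average w m s n g - root_average w m s n h.
Proof.
rewrite -mulrBr -sumrB; congr (_ * _).
by apply: eq_bigr => k _; rewrite mulrBl.
Qed.

End RootAverage.

Section TaylorFunctional.
Context (R : realType).
Implicit Types (g : R[i] -> R[i]) (p : {poly R[i]}).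

(** Averaging over roots of unity of order [size p] causes no aliasing, so a single coefficient is
    isolated exactly. *)
Lemma cauchy_estimate p (r B : R) j : 0 < r ->
  (forall z, rnorm z <= r -> rnorm p.[z] <= B) -> rnorm p`_j * r ^+ j <= B.
Proof.
move=> r0 pB.
have B0 : 0 <= B by rewrite (le_trans (rnorm_ge0 p.[0]))// pB// rnorm0 ltW.
have [pj|pj] := leqP (size p) j; first by rewrite nth_default// rnorm0 mul0r.
have [w wP] : exists w : R[i], (size p).-primitive_root w.
  by apply: complex_prim_root_exists; rewrite (leq_ltn_trans _ pj).
have := @root_average_le _ _ _ wP (fun z => p.[z]) r%:C j B.
rewrite rnorm_real gtr0_norm// root_average_horner// => /(_ _).
rewrite (bigD1 (Ordinal pj))//= big1 => [|i /andP[]]; last first.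
  by rewrite (eq_prim_root_expr wP) !modn_small// -(inj_eq val_inj)/= => ->.
rewrite addr0 rnormM rnormX rnorm_real gtr0_norm//; apply.
by move=> z zr; rewrite pB// zr.
Qed.

Context (w : R[i]) (m n : nat) (w_prim : m.-primitive_root w) (nm : (n < m)%N).

(** Sampling is on the circle of radius 1/2; the factor [2 ^+ n] normalizes this to the n-th
    coefficient for polynomials of degree less than [m]. *)
Definition taylor g : R[i] := 2 ^+ n * root_average w m 2^-1 n g.

Lemma taylor_le g B : (forall z, rnorm z = 2^-1 -> rnorm (g z) <= B) ->
  rnorm (taylor g) <= 2 ^+ n * B.
Proof.
move=> gB; rewrite rnormM rnormX rnorm_nat ler_wpM2l ?exprn_ge0//.
by apply: root_average_le => // z; rewrite rnormV rnorm_nat; exact: gB.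
Qed.

(** No exponent below [n] aliases with [n], because [n < m]. By Cauchy's estimate on radius r the
    exponents j >= n contribute at most r^-n B times powers of 1 / (2r) <= 2/3, whence 2 B * 3. *)
Lemma taylor_poly_le p (r B : R) : 3 / 4 <= r -> 2^-1 <= r ^+ n ->
  (forall z, rnorm z <= r -> rnorm p.[z] <= B) ->
  rnorm (taylor (fun z => p.[z])) <= 6 * B.
Proof.
move=> r34 rn pB; have r0 : 0 < r by rewrite (lt_le_trans _ r34)// divr_gt0.
have B0 : 0 <= B by rewrite (le_trans (rnorm_ge0 p.[0]))// pB// rnorm0 ltW.
have rn0 : 0 < r ^+ n by rewrite exprn_gt0.
rewrite /taylor root_average_horner// rnormM rnormX rnorm_nat.
have t0 : 0 <= (2 * r)^-1 by rewrite invr_ge0 mulr_ge0// ltW.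
have geo N : \sum_(j < N | (n <= j)%N) 2 ^+ n * (rnorm p`_j * 2 ^- j) <=
    (r ^+ n)^-1 * B * \sum_(j < N | (n <= j)%N) (2 * r)^-1 ^+ (j - n).
  rewrite mulr_sumr ler_sum// => j nj.
  have -> : 2 ^+ n * (rnorm p`_j * 2 ^- j) =
     (r ^+ n)^-1 * (rnorm p`_j * r ^+ j) * (2 * r)^-1 ^+ (j - n).
    move: (rnorm _) => a; rewrite -{1 2}(subnK nj) !exprD exprVn exprMn.
    have r_neq0 k : r ^+ k != 0 by rewrite expf_neq0// gt_eqF.
    have two_neq0 k : 2 ^+ k != 0 :> R by rewrite expf_neq0// pnatr_eq0.
    move: (r_neq0 n) (r_neq0 (j - n)%N) (two_neq0 n) (two_neq0 (j - n)%N).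
    move: (r ^+ n) (r ^+ (j - n)) (2 ^+ n) (2 ^+ (j - n)) => x y u v x0 y0 u0 v0.
    by field; rewrite x0 y0 u0 v0.
  rewrite ler_wpM2r ?exprn_ge0// ler_wpM2l ?invr_ge0 ?(ltW rn0)//.
  exact: cauchy_estimate.
have geo3 N : \sum_(j < N | (n <= j)%N) (2 * r)^-1 ^+ (j - n) <= 3.
  have t23 : (2 * r)^-1 <= 2 / 3.
    by rewrite -[2 / 3]invrK lef_pV2 ?posrE ?invr_gt0 ?divr_gt0 ?mulr_gt0//; lra.
  apply: (@le_trans _ _ (\sum_(j < N | (n <= j)%N) (2 / 3) ^+ (j - n))).
    by apply: ler_sum => j _; rewrite lerXn2r// nnegrE// divr_ge0.
  rewrite -(big_mkord (leq n) (fun j => (2 / 3 : R) ^+ (j - n))).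
  (* The value of the geometric sum, written so as to be 0 while [N] is below [n] and the sum is
     empty. *)
  suff: \sum_(0 <= j < N | (n <= j)%N) (2 / 3 : R) ^+ (j - n) <=
      3 - 3 * (if (n <= N)%N then (2 / 3) ^+ (N - n) else 1).
    move=> /le_trans; apply; rewrite lerBlDr lerDl mulr_ge0//.
    by case: ifP => // _; rewrite exprn_ge0// divr_ge0.
  elim: N => [|N IHN].
    by rewrite big_nil; case: n => [|?] /=; rewrite ?expr0; lra.
  rewrite big_mkcond big_nat_recr//= -big_mkcond/=.
  apply: le_trans (lerD IHN (lexx _)) _.
  have [nN|Nn] := leqP n N.
    rewrite leqW// subSn// exprS; lra.
  case: ifP => nN; last lra.
  by have -> : n = N.+1 by [apply/eqP; rewrite eqn_leq nN Nn]; rewrite subnn expr0; lra.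
apply: (@le_trans _ _ (\sum_(j < size p | (n <= j)%N) 2 ^+ n * (rnorm p`_j * 2 ^- j))).
  rewrite -mulr_sumr ler_wpM2l ?exprn_ge0//.
  apply: (le_trans (rnorm_sum _ _ _)).
  rewrite big_mkcond [leRHS]big_mkcond/=; apply: ler_sum => j _.
  rewrite rnormM exprVn rnormV rnormX rnorm_nat.
  have jB : 0 <= rnorm p`_j * 2 ^- j by rewrite mulr_ge0 ?rnorm_ge0 ?invr_ge0 ?exprn_ge0.
  have [nj|nj] := leqP n j; first by case: ifP.
  by rewrite (eq_prim_root_expr w_prim) !modn_small ?(ltn_trans nj)// ltn_eqF.
apply: (le_trans (geo _)).
have rB : (r ^+ n)^-1 * B <= 2 * B.
  by rewrite ler_wpM2r// -[2]invrK lef_pV2// posrE invr_gt0.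
have -> : 6 * B = 2 * B * 3 by ring.
rewrite ler_pM//; first by rewrite mulr_ge0 ?invr_ge0 ?(ltW rn0).
by rewrite sumr_ge0// => j _; rewrite exprn_ge0.
Qed.

Lemma taylor_approximable_le g (r B : R) : 3 / 4 <= r -> 2^-1 <= r ^+ n ->
  poly_approximable r g -> (forall z, rnorm z <= r -> rnorm (g z) <= B) ->
  rnorm (taylor g) <= 6 * B.
Proof.
move=> r34 rn ga gB; apply/ler_addgt0Pr => e e0.
(* The approximation error costs [2 ^+ n * d] on the circle of radius 1/2 and [6 * d] in the
   polynomial estimate. *)
pose d := e / (6 + 2 ^+ n).
have c0 : 0 < 6 + 2 ^+ n :> R by rewrite addr_gt0 ?exprn_gt0.
have d0 : 0 < d by rewrite divr_gt0.
have [p pP] := ga _ d0.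
have gp : rnorm (taylor g - taylor (fun z => p.[z])) <= 2 ^+ n * d.
  rewrite -mulrBr -root_averageB; apply: taylor_le => z z2.
  by rewrite pP// z2; lra.
have pB : rnorm (taylor (fun z => p.[z])) <= 6 * (B + d).
  apply: taylor_poly_le r34 rn _ => z zr.
  rewrite -[p.[z]](subrK (g z)) addrC (le_trans (rnormD _ _))// lerD ?gB//.
  by rewrite rnormB pP.
rewrite -[taylor g](subrK (taylor (fun z => p.[z]))).
rewrite (le_trans (rnormD _ _))// (le_trans (lerD gp pB))//.
have -> : e = (6 + 2 ^+ n) * d by rewrite mulrC divfK// gt_eqF.
nra.
Qed.

End TaylorFunctional.

(** * Functionals localized at a scale *)

Section Cayley.
Context (R : realType).
Implicit Types (z s u v : R[i]) (a r k : R).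

Definition cayley z : R[i] := (1 - z) / (1 + z).

Lemma sqr_rnorm1D u : rnorm (1 + u) ^+ 2 = 1 + 2 * complex.Re u + rnorm u ^+ 2.
Proof. by rewrite !sqr_rnorm; case: u => x y /=; ring. Qed.

Lemma sqr_rnorm1B u : rnorm (1 - u) ^+ 2 = 1 - 2 * complex.Re u + rnorm u ^+ 2.
Proof. by rewrite !sqr_rnorm; case: u => x y /=; ring. Qed.

(** The identity 1 - |s|^2 = 4 Re v / |1 + v|^2 behind the correspondence between the disc and the
    right half-plane. *)
Lemma Re_cayley v : 1 + v != 0 ->
  4 * complex.Re v = (1 - rnorm (cayley v) ^+ 2) * rnorm (1 + v) ^+ 2.
Proof.
move=> v0; rewrite mulrBl -exprMn -rnormM divfK// sqr_rnorm1D sqr_rnorm1B; ring.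
Qed.

Lemma onem_sqr_cayley v : 1 + v != 0 -> 1 - cayley v ^+ 2 = 4 * v / (1 + v) ^+ 2.
Proof. by move=> v0; rewrite /cayley; field. Qed.

Lemma onep_cayley v : 1 + v != 0 -> 1 + cayley v = 2 / (1 + v).
Proof. by move=> v0; rewrite /cayley; field. Qed.

Lemma onep_cayley_neq0 v : 1 + v != 0 -> 1 + cayley v != 0.
Proof. by move=> v0; rewrite onep_cayley// mulf_neq0 ?invr_neq0 ?pnatr_eq0. Qed.

Lemma cayleyK v : 1 + v != 0 -> cayley (cayley v) = v.
Proof.
move=> v0; rewrite {1}/cayley onep_cayley// /cayley; field.
exact: v0.
Qed.

Lemma onep_neq0 z : rnorm z < 1 -> 1 + z != 0.
Proof.
by apply: contraTneq => /eqP; rewrite addrC addr_eq0 => /eqP ->; rewrite rnormN rnorm1 ltxx.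
Qed.

Lemma rnorm1D_ge z r : rnorm z <= r -> 1 - r <= rnorm (1 + z).
Proof.
move=> zr; have := rnorm_subr_ge 1 (- z); rewrite rnorm1 rnormN opprK.
by apply: le_trans; rewrite lerD2l lerN2.
Qed.

Lemma rnorm1D_le z r : rnorm z <= r -> rnorm (1 + z) <= 1 + r.
Proof. by move=> zr; rewrite (le_trans (rnormD _ _))// rnorm1 lerD2l. Qed.

Lemma cayley_le z r : rnorm z <= r -> r < 1 -> rnorm (cayley z) <= (1 + r) / (1 - r).
Proof.
move=> zr r1; rewrite rnormf_div ler_pM ?invr_ge0 ?rnorm_ge0//.
  by rewrite rnorm1D_le// rnormN.
have r0 : 0 < 1 - r by rewrite subr_gt0.
by rewrite lef_pV2 ?posrE ?rnorm1D_ge// (lt_le_trans r0)// rnorm1D_ge.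
Qed.

Lemma cayley_ge z r : rnorm z <= r -> r < 1 -> (1 - r) / (1 + r) <= rnorm (cayley z).
Proof.
move=> zr r1; have r0 : 0 < 1 - r by rewrite subr_gt0.
have z0 : 0 < rnorm (1 + z) by rewrite (lt_le_trans r0)// rnorm1D_ge.
have r0' : 0 <= r by rewrite (le_trans (rnorm_ge0 z)).
rewrite rnormf_div ler_pM ?invr_ge0 ?(ltW r0) ?addr_ge0//.
  by rewrite rnorm1D_ge// rnormN.
by rewrite lef_pV2 ?posrE ?rnorm1D_le// ltr_wpDr.
Qed.

Lemma Re_cayley_ge z r : rnorm z <= r -> r < 1 -> (1 - r ^+ 2) / 4 <= complex.Re (cayley z).
Proof.
move=> zr r1; have r0 : 0 <= r by rewrite (le_trans (rnorm_ge0 z)).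
have z1 : 1 + z != 0 by rewrite onep_neq0// (le_lt_trans zr).
(* The Cayley transform is an involution, so the identity is applied to v = [cayley z], where |1 +
   v| = 2 / |1 + z| >= 1. *)
have := Re_cayley (onep_cayley_neq0 z1); rewrite cayleyK// onep_cayley//.
rewrite rnormf_div rnorm_nat => E.
have z0 : 0 < rnorm (1 + z) by rewrite lt_def rnorm_eq0 z1 rnorm_ge0.
have h1 : 1 <= 2 / rnorm (1 + z).
  by rewrite ler_pdivlMr// mul1r (le_trans (rnorm1D_le zr))//; lra.
have h2 : 1 <= (2 / rnorm (1 + z)) ^+ 2 by rewrite exprn_ege1.
have h3 : rnorm z ^+ 2 <= r ^+ 2 by rewrite lerXn2r// nnegrE rnorm_ge0.
have h4 : r ^+ 2 <= 1 by rewrite exprn_ile1// ltW.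
suff : 1 - r ^+ 2 <= 4 * complex.Re (cayley z) by lra.
rewrite E; move: h2 h3 h4; set A := _ ^+ 2; set B := _ ^+ 2; set D := _ ^+ 2.
move=> ? ? ?; nra.
Qed.

(** The point x whose rescaled variable (1 - x) / a has Cayley transform z. *)
Definition node a z : R[i] := 1 - a%:C * cayley z.

Lemma sqr_rnorm_node a z : rnorm (node a z) ^+ 2 =
  1 - 2 * a * complex.Re (cayley z) + a ^+ 2 * rnorm (cayley z) ^+ 2.
Proof. by rewrite /node !sqr_rnorm; case: (cayley z) => x y /=; ring. Qed.

Lemma onem_node a z : 1 - node a z = a%:C * cayley z.
Proof. by rewrite /node opprB addrCA subrr addr0. Qed.

End Cayley.

(** * Distance from the nodes to the poles *)

Section ScaleFunctional.
Context (R : realType) (rho kappa : R).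
Hypotheses (rho34 : 3 / 4 <= rho) (rho1 : rho < 1) (kappaE : kappa = (1 - rho) / 2).
Implicit Types (z : R[i]) (l : pole R) (a : R) (f : {poly R[i]}) (L : seq (pole R)).

Let kappa0 : 0 < kappa. Proof. by rewrite kappaE; move: rho1 => h; lra. Qed.
Let kappa8 : kappa <= 1 / 8. Proof. by rewrite kappaE; move: rho34 => h; lra. Qed.

(** Put u = [cayley z]. The choice of [kappa] gives |u| <= 1 / kappa and Re u >= kappa / 2, so in |1
    - a u|^2 = 1 - 2 a Re u + a^2 |u|^2 the quadratic term is at most a kappa / 2, half of what the
    linear term removes. *)
Lemma node_lt1 a z : 0 < a -> a <= kappa ^+ 3 / 2 -> rnorm z <= rho -> rnorm (node a z) < 1.
Proof.
move=> a0 ak zr; have r34 := rho34; have r1 := rho1.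
have U := cayley_le zr rho1; have V := Re_cayley_ge zr rho1.
have U' : rnorm (cayley z) <= kappa^-1.
  apply: (le_trans U); rewrite kappaE invfM invrK mulrC ler_wpM2l ?invr_ge0 ?subr_ge0 1?ltW//.
  by lra.
have kU : kappa * rnorm (cayley z) <= 1 by rewrite -ler_pdivlMl ?mulr1.
have kU2 : kappa ^+ 2 * rnorm (cayley z) ^+ 2 <= 1.
  by rewrite -exprMn exprn_ile1// mulr_ge0 ?rnorm_ge0// ltW.
have V' : kappa / 2 <= complex.Re (cayley z).
  by apply: le_trans V; rewrite kappaE; nra.
rewrite -(ltr_pXn2r (n := 2)) ?nnegrE ?rnorm_ge0// expr1n sqr_rnorm_node.
have W : a * rnorm (cayley z) ^+ 2 <= kappa / 2.
  have : a * rnorm (cayley z) ^+ 2 <= kappa ^+ 3 / 2 * rnorm (cayley z) ^+ 2.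
    by rewrite ler_wpM2r ?sqr_ge0.
  move=> /le_trans; apply.
  have -> : kappa ^+ 3 / 2 * rnorm (cayley z) ^+ 2 =
    kappa / 2 * (kappa ^+ 2 * rnorm (cayley z) ^+ 2) by ring.
  by rewrite ler_piMr// divr_ge0// ltW.
have := ler_wpM2l (ltW a0) V'; have := ler_wpM2l (ltW a0) W.
have : 0 < a * (kappa / 2) by rewrite mulr_gt0// divr_gt0.
set x := complex.Re _; set y := rnorm _ ^+ 2 => c h1 h2.
have -> : 1 - 2 * a * x + a ^+ 2 * y = 1 - 2 * (a * x) + a * (a * y) by ring.
by move: h1 h2 c; move: (a * x) (a * (a * y)) (a * (kappa / 2)) => *; lra.
Qed.

(** The node x satisfies |x| <= 1 - a / 8 and |1 - x| <= 3 a. As |l| > 1, |l - x| >= a / 8, so |l -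
    1| <= |l - x| + 3 a <= (1 + 24) |l - x|. *)
Lemma pole_ratio_half a z l : 0 < a -> a <= kappa ^+ 3 / 2 -> rnorm z <= 2^-1 ->
  rnorm (val l - 1) <= 25 * rnorm (val l - node a z).
Proof.
move=> a0 ak zr; have half1 : 2^-1 < 1 :> R by lra.
have a72 : a <= 1 / 72.
  by have := kappa0; have := kappa8; move: ak; move: kappa => k; nra.
have := cayley_le zr half1; have := Re_cayley_ge zr half1.
have := sqr_rnorm_node a z; have := onem_node a z.
set x := node a z; set u := cayley z => xE x2 Ru Nu.
have u3 : rnorm u <= 3 by apply: (le_trans Nu); rewrite ler_pdivrMr; lra.
have Ru' : 3 / 16 <= complex.Re u by apply: le_trans Ru; lra.
have u9 : rnorm u ^+ 2 <= 9.
  by have -> : 9 = 3 ^+ 2 :> R by [ring]; rewrite lerXn2r ?nnegrE ?rnorm_ge0.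
have x1 : rnorm x <= 1 - a / 8.
  rewrite -(ler_pXn2r (n := 2)) ?nnegrE ?rnorm_ge0//; last by lra.
  by rewrite x2; move: Ru' u9; set A := complex.Re _; set B := rnorm u ^+ 2; nra.
have lx : a / 8 <= rnorm (val l - x).
  apply: le_trans (rnorm_subr_ge _ _); have := valP l => /= l1; lra.
have : rnorm (val l - 1) <= rnorm (val l - x) + 3 * a.
  have -> : val l - 1 = val l - x - (1 - x) by ring.
  rewrite (le_trans (rnormD _ _))// rnormN xE rnormM rnorm_real gtr0_norm//.
  by rewrite lerD2l mulrC ler_wpM2r// ltW.
by lra.
Qed.

Definition bad_scale a l :=
  (a * kappa / 2 < rnorm (val l - 1)) && (rnorm (val l - 1) < 2 * a / kappa).

(** Here |1 - x| lies between a kappa and a / kappa. Off the bad range, |l - 1| and |1 - x| differ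
    by a factor of at least 2, and the triangle inequality gives |l - 1| <= 2 |l - x|. *)
Lemma pole_ratio_good a z l : 0 < a -> rnorm z <= rho -> ~~ bad_scale a l ->
  rnorm (val l - 1) <= 25 * rnorm (val l - node a z).
Proof.
move=> a0 zr; rewrite negb_and -!leNgt => good.
have [[r34 r1] k0] := (rho34, rho1, kappa0).
have U := cayley_le zr rho1; have V := cayley_ge zr rho1.
have kV0 : 0 < kappa^-1 by rewrite invr_gt0.
have U' : rnorm (cayley z) <= kappa^-1.
  apply: (le_trans U); rewrite kappaE invfM invrK mulrC ler_wpM2l ?invr_ge0 ?subr_ge0 1?ltW//.
  by lra.
have V' : kappa <= rnorm (cayley z).
  apply: le_trans V; rewrite kappaE ler_wpM2l ?subr_ge0 ?(ltW rho1)//.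
  by rewrite lef_pV2 ?posrE; lra.
have N : rnorm (1 - node a z) = a * rnorm (cayley z).
  by rewrite onem_node rnormM rnorm_real gtr0_norm.
have t1 := rnorm_subr_ge (val l - 1) (node a z - 1).
have t2 := rnorm_subr_ge (node a z - 1) (val l - 1).
have e1 : val l - 1 - (node a z - 1) = val l - node a z by ring.
have e2 : node a z - 1 - (val l - 1) = - (val l - node a z) by ring.
rewrite e1 (rnormB (node a z)) N in t1; rewrite e2 rnormN (rnormB (node a z)) N in t2.
have P := rnorm_ge0 (val l - node a z).
case/orP: good => good.
  by have : a * kappa <= a * rnorm (cayley z) by [rewrite ler_wpM2l// ltW]; lra.
have : a * rnorm (cayley z) <= a * kappa^-1 by rewrite ler_wpM2l// ltW.
by lra.
Qed.

End ScaleFunctional.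

Section TaylorLinear.
Context (R : realType) (w : R[i]) (m n : nat) (w_prim : m.-primitive_root w).
Implicit Types g h : R[i] -> R[i].
Local Notation taylor := (taylor w m n).

Lemma taylor_ext g h : (forall z, rnorm z = 2^-1 -> g z = h z) -> taylor g = taylor h.
Proof.
move=> gh; congr (_ * (_ * _)); apply: eq_bigr => k _; rewrite gh//.
by rewrite rnormM (rnorm_prim_root w_prim) mulr1 rnormV rnorm_nat.
Qed.

Lemma taylorB g h : taylor (fun z => g z - h z) = taylor g - taylor h.
Proof. by rewrite /taylor root_averageB mulrBr. Qed.

Lemma taylorD g h : taylor (fun z => g z + h z) = taylor g + taylor h.
Proof.
rewrite -mulrDr -mulrDr -big_split; congr (_ * (_ * _)).
by apply: eq_bigr => k _; rewrite mulrDl.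
Qed.

Lemma taylorZ a g : taylor (fun z => a * g z) = a * taylor g.
Proof.
rewrite /taylor /root_average !(mulrCA a); congr (_ * (_ * _)); rewrite mulr_sumr.
by apply: eq_bigr => k _; rewrite mulrA.
Qed.

End TaylorLinear.

Section ScaleFunctional.
Context (R : realType) (rho kappa : R).
Hypotheses (rho34 : 3 / 4 <= rho) (rho1 : rho < 1) (kappaE : kappa = (1 - rho) / 2).
Context (w : R[i]) (m n : nat) (w_prim : m.-primitive_root w) (nm : (n < m)%N).
Hypothesis rho_n : 2^-1 <= rho ^+ n.
Implicit Types (z : R[i]) (l : pole R) (f : {poly R[i]}) (L : seq (pole R)).

Definition pole_ratio l z : R[i] := pole_factor l / (val l - z).

Definition pole_product (i : symbol R) z : R[i] :=
  i.1.[z] * \prod_(l <- i.2) pole_ratio l z.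

Context (a : R) (a0 : 0 < a) (ak : a <= kappa ^+ 3 / 2).

Definition scale_functional (i : symbol R) : R[i] :=
  taylor w m n (fun z => pole_product i (node a z)).

Lemma node_half_lt1 z : rnorm z = 2^-1 -> rnorm (node a z) < 1.
Proof.
move=> z2; apply: (node_lt1 rho34 rho1 kappaE) => //; rewrite z2.
by move: rho34 => h; lra.
Qed.

Lemma pole_sub_neq0 l z : rnorm z < 1 -> val l - z != 0.
Proof.
move=> z1; rewrite subr_eq0; apply: contraTneq (valP l) => /= ->.
by rewrite -leNgt ltW.
Qed.

(** The functional only sees values of the actual rational function at points of the open disc,
    where no l - z vanishes. *)
Lemma scale_functional_compatible : compatible scale_functional.
Proof.
split=> [b f g L|f L1 l L2]; rewrite /scale_functional -taylorZ.
  rewrite -taylorD; apply: taylor_ext => // z _.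
  by rewrite /pole_product/= hornerD hornerZ mulrDl mulrA.
apply: taylor_ext => // z /node_half_lt1 z1; rewrite /pole_product/=.
rewrite hornerM hornerD hornerN hornerX hornerC !big_cat big_cons/= /pole_ratio.
have := pole_sub_neq0 l z1; move: (val l - node a z) => d d0.
move: (\prod_(_ <- L1) _) (\prod_(_ <- L2) _) f.[_] (pole_factor l) => A B c p.
by field.
Qed.

Lemma node_approximable : poly_approximable rho (node a).
Proof.
have rho0 : 0 <= rho by move: rho34 => h; lra.
have inv : poly_approximable rho (fun z => (1 + 1 * z)^-1).
  by apply: poly_approximable_inv_affine => // z zr; rewrite mul1r onep_neq0// (le_lt_trans zr).
have := poly_approximableM (@poly_approximable_horner _ rho ((- a%:C)%:P * (1 - 'X))) inv.
move=> /(poly_approximableD (poly_approximable_cst rho 1)).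
apply: poly_approximable_ext => z _.
rewrite hornerM hornerC hornerD hornerN hornerX hornerC mul1r /node /cayley; ring.
Qed.

(** The quotient is a Moebius function of z. Its denominator has no zero on the disc of radius
    [rho], because the nodes stay in the open unit disc while |l| > 1. *)
Lemma pole_ratio_approximable l :
  poly_approximable rho (fun z => pole_ratio l (node a z)).
Proof.
have rho0 : 0 <= rho by move: rho34 => h; lra.
have den z : rnorm z <= rho -> val l - node a z =
    ((val l - 1 + a%:C) + (val l - 1 - a%:C) * z) / (1 + z).
  by move=> zr; rewrite /node /cayley; field; rewrite onep_neq0// (le_lt_trans zr).
have den0 z : rnorm z <= rho -> (val l - 1 + a%:C) + (val l - 1 - a%:C) * z != 0.
  move=> zr; have := pole_sub_neq0 l (node_lt1 rho34 rho1 kappaE a0 ak zr).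
  by rewrite den// mulf_eq0 negb_or => /andP[].
have := poly_approximableM (@poly_approximable_horner _ rho ((pole_factor l)%:P * (1 + 'X)))
  (poly_approximable_inv_affine rho0 den0).
apply: poly_approximable_ext => z zr; rewrite /pole_ratio den//.
rewrite hornerM hornerC hornerD hornerX hornerC; field.
by rewrite den0//= onep_neq0// (le_lt_trans zr).
Qed.

Lemma pole_product_approximable i :
  poly_approximable rho (fun z => pole_product i (node a z)).
Proof.
apply: poly_approximableM.
  exact: poly_approximable_comp node_approximable.
by apply: poly_approximable_prod => l; exact: pole_ratio_approximable.
Qed.

Lemma pole_ratio_le l z : rnorm (val l - 1) <= 25 * rnorm (val l - z) ->
  rnorm (pole_ratio l z) <= 2^-1.
Proof.
move=> lz; rewrite rnormf_div rnormM rnorm_real ger0_norm ?invr_ge0//.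
have [->|z0] := eqVneq (val l - z) 0; first by rewrite rnorm0 invr0 mulr0 invr_ge0.
rewrite ler_pdivrMr ?lt_def ?rnorm_eq0 ?z0 ?rnorm_ge0//; lra.
Qed.

Lemma pole_product_le f L z : rnorm z < 1 ->
  (forall l, l \in L -> rnorm (val l - 1) <= 25 * rnorm (val l - z)) ->
  rnorm (pole_product (f, L) z) <= 2 ^- size L * disc_sup f.
Proof.
move=> z1 Lz; rewrite rnormM mulrC ler_pM ?rnorm_ge0 ?le_disc_sup//=.
elim: L Lz => [|l L IHL] Lz; first by rewrite big_nil rnorm1 expr0 invr1.
rewrite big_cons rnormM exprS invfM ler_pM ?rnorm_ge0//.
  by apply: pole_ratio_le; apply: Lz; rewrite inE eqxx.
by apply: IHL => l' l'L; apply: Lz; rewrite inE l'L orbT.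
Qed.

(** With no bad pole, the estimate on the disc of radius [rho] costs only 6; otherwise the circle of
    radius 1/2 is used at a cost of [2 ^+ n]. The number of bad poles appears in the bound so that
    it can be summed over scales. *)
Lemma scale_functional_le f L : rnorm (scale_functional (f, L)) <=
  2 ^- size L * (6 + 2 ^+ n * (count (bad_scale kappa a) L)%:R) * disc_sup f.
Proof.
have D0 := disc_sup_ge0 f; have S0 : 0 <= 2 ^- size L :> R by rewrite invr_ge0 exprn_ge0.
have half_rho : 2^-1 <= rho by move: rho34 => h; lra.
have [hasbad|/hasPn good] := boolP (has (bad_scale kappa a) L).
  apply: (@le_trans _ _ (2 ^+ n * (2 ^- size L * disc_sup f))).
    apply: taylor_le => // z z2; apply: pole_product_le; first exact: node_half_lt1.
    by move=> l _; apply: (pole_ratio_half rho34 rho1 kappaE); rewrite // z2.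
  rewrite mulrA ler_wpM2r// mulrC ler_wpM2l//.
  rewrite -[leLHS]add0r lerD// ler_peMr ?exprn_ge0//.
  by rewrite ler1n -has_count.
have count0 : count (bad_scale kappa a) L = 0%N.
  by apply/eqP; rewrite -leqn0 leqNgt -has_count; apply/hasPn.
rewrite count0 mulr0 addr0 [_ * 6]mulrC -mulrA.
apply: (taylor_approximable_le w_prim nm rho34 rho_n (pole_product_approximable _)).
move=> z zr; apply: pole_product_le; first exact: (node_lt1 rho34 rho1 kappaE).
by move=> l lL; apply: (pole_ratio_good rho34 rho1 kappaE) => //; exact: good.
Qed.

End ScaleFunctional.

Lemma sum_unique_le1 N (P : pred 'I_N) :
  (forall i j, P i -> P j -> i = j) -> (\sum_(j < N) P j <= 1)%N.
Proof.
move=> uniqP; rewrite -big_mkcond sum1_card; apply/card_le1_eqP => i j Pi Pj.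
exact: uniqP.
Qed.

(** * Averaging over sparse scales *)

Section MultiscaleFunctional.
Context (R : realType) (rho kappa q : R).
Hypotheses (rho34 : 3 / 4 <= rho) (rho1 : rho < 1) (kappaE : kappa = (1 - rho) / 2).
Hypotheses (q0 : 0 < q) (qk : q <= kappa ^+ 3 / 2).
Context (w : R[i]) (m n : nat) (w_prim : m.-primitive_root w) (nm : (n < m)%N).
Hypothesis rho_n : 2^-1 <= rho ^+ n.

Definition scale (j : nat) : R := q ^+ j.+1.

Lemma q_le1 : q <= 1 / 1000.
Proof.
have k8 : kappa <= 1 / 8 by rewrite kappaE; move: rho34 => h; lra.
have k0 : 0 < kappa by rewrite kappaE; move: rho1 => h; lra.
have : kappa ^+ 3 <= (1 / 8) ^+ 3 by rewrite lerXn2r// nnegrE// ltW.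
move: qk => h h'; apply: (le_trans h); apply: (@le_trans _ _ ((1 / 8) ^+ 3 / 2)).
  by rewrite ler_wpM2r.
by lra.
Qed.

Lemma scale_gt0 j : 0 < scale j. Proof. exact: exprn_gt0. Qed.

Lemma scale_le j : scale j <= kappa ^+ 3 / 2.
Proof.
rewrite (le_trans _ qk)// /scale exprS ler_piMr ?(ltW q0)// exprn_ile1// ?(ltW q0)//.
by have := q_le1; lra.
Qed.

Lemma scale_ratio_le i j : (i < j)%N -> scale j <= q * scale i.
Proof.
move=> ij; rewrite /scale -exprS -(subnKC ij) -addSn exprD ler_piMr//.
  by rewrite exprn_ge0// ltW.
by rewrite exprn_ile1// ?(ltW q0)//; have := q_le1; lra.
Qed.

(** Two scales bad for the same pole have ratio greater than kappa^2 / 4, whereas distinct scales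
    have ratio at most q <= kappa^2 / 4. *)
Lemma bad_scale_unique l i j :
  bad_scale kappa (scale i) l -> bad_scale kappa (scale j) l -> i = j.
Proof.
wlog ij : i j / (i < j)%N => [wl bi bj|].
  have [ij|ji|//] := ltngtP i j; first exact: wl.
  by apply/esym/wl.
move=> /andP[bi _] /andP[_ bj]; exfalso; have := lt_trans bi bj.
have k0 : 0 < kappa by rewrite kappaE; move: rho1 => h; lra.
have k8 : kappa <= 1 / 8 by rewrite kappaE; move: rho34 => h; lra.
rewrite ltr_pdivlMr//; apply/negP; rewrite -leNgt.
have s0 := scale_gt0 i; have := scale_ratio_le ij; have h := qk.
have q4 : q <= kappa ^+ 2 / 4.
  apply: (le_trans h); rewrite exprS mulrC mulrA; rewrite -subr_ge0.
  have -> : kappa ^+ 2 / 4 - 2^-1 * kappa * kappa ^+ 2 =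
    kappa ^+ 2 * (1 / 4 - kappa / 2) by field.
  by rewrite mulr_ge0 ?sqr_ge0//; lra.
have := ler_wpM2r (ltW s0) q4.
have -> : scale i * kappa / 2 * kappa = 2 * (kappa ^+ 2 / 4 * scale i) by field.
by move: (q * scale i) (kappa ^+ 2 / 4 * scale i) => x y; lra.
Qed.

Lemma sum_bad_scale_le N (L : seq (pole R)) :
  (\sum_(j < N) count (bad_scale kappa (scale j)) L <= size L)%N.
Proof.
elim: L => [|l L IHL]; first by rewrite big1.
rewrite big_split/= -add1n leq_add// sum_unique_le1// => i j bi bj.
exact/val_inj/(bad_scale_unique bi bj).
Qed.

Definition multiscale (i : symbol R) : R[i] :=
  (2 ^+ n)^-1 * \sum_(j < 2 ^ n) scale_functional w m n (scale j) i.

Lemma multiscale_compatible : compatible multiscale.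
Proof.
have compat j := scale_functional_compatible rho34 rho1 kappaE n w_prim
  (scale_gt0 j) (scale_le j).
split=> [b f g L|f L1 l L2]; rewrite /multiscale.
  rewrite mulrCA -mulrDr; congr (_ * _); rewrite mulr_sumr -big_split.
  by apply: eq_bigr => j _; rewrite (compat j).1.
rewrite [RHS]mulrCA; congr (_ * _); rewrite mulr_sumr.
by apply: eq_bigr => j _; rewrite (compat j).2.
Qed.

(** Over [2 ^ n] scales the bad terms add up to at most [2 ^+ n * size L], so the average is at most
    2^-k (6 + k) <= 7 with k = [size L]. *)
Lemma multiscale_le f L : rnorm (multiscale (f, L)) <= 7 * disc_sup f.
Proof.
have D0 := disc_sup_ge0 f.
have S0 : 0 < 2 ^+ size L :> R by rewrite exprn_gt0.
have N0 : 0 < 2 ^+ n :> R by rewrite exprn_gt0.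
rewrite rnormM rnormV rnormX rnorm_nat ler_pdivrMl//.
apply: (le_trans (rnorm_sum _ _ _)).
apply: (@le_trans _ _ (\sum_(j < 2 ^ n) 2 ^- size L *
    (6 + 2 ^+ n * (count (bad_scale kappa (scale j)) L)%:R) * disc_sup f)).
  apply: ler_sum => j _; apply: (scale_functional_le rho34 rho1 kappaE) => //.
    exact: scale_gt0.
  exact: scale_le.
rewrite -mulr_suml -mulr_sumr mulrA ler_wpM2r//.
have -> : \sum_(j < 2 ^ n) (6 + 2 ^+ n * (count (bad_scale kappa (scale j)) L)%:R) =
    6 * 2 ^+ n + 2 ^+ n * (\sum_(j < 2 ^ n) count (bad_scale kappa (scale j)) L)%:R :> R.
  rewrite big_split/= -mulr_sumr natr_sum sumr_const card_ord -[LHS]/(6 *+ _ + _).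
  by rewrite -(mulr_natr 6) natrX.
rewrite mulrC ler_pdivrMr//.
have c1 : (\sum_(j < 2 ^ n) count (bad_scale kappa (scale j)) L)%:R <= 2 ^+ size L :> R.
  rewrite -natrX ler_nat (leq_trans (sum_bad_scale_le _ _))// ltnW//.
  exact: ltn_expl.
have s1 : 1 <= 2 ^+ size L :> R by rewrite exprn_ege1// ler1n.
have := ler_wpM2l (ltW N0) c1; have := ler_wpM2l (ltW N0) s1.
move: (\sum_(j < _) _)%:R => c. move: (2 ^+ size L) (2 ^+ n) => x y. lra.
Qed.

Definition multiscale_mem :
  multiscale \in annihilator (@weight R) (@relations R) :=
  mem_functional (ler0n _ 7) multiscale_compatible multiscale_le.

End MultiscaleFunctional.

(** * Bumps and the test function *)

Section Hump.
Context (R : realType).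
Implicit Types (t x q : R).

(** Bound n x^n by the geometric sum of the lower powers; times 1 - x it telescopes. *)
Lemma exprn_onem_le x n : 0 <= x -> x <= 1 -> n%:R * x ^+ n * (1 - x) <= 1.
Proof.
move=> x0 x1; have xn : n%:R * x ^+ n <= \sum_(i < n) x ^+ i.
  rewrite mulr_natl -[in leLHS](card_ord n) -sumr_const ler_sum// => i _.
  by rewrite card_ord; apply: ler_wiXn2l => //; exact: ltnW.
apply: (@le_trans _ _ ((\sum_(i < n) x ^+ i) * (1 - x))).
  by rewrite ler_wpM2r// subr_ge0.
have -> : (\sum_(i < n) x ^+ i) * (1 - x) = 1 - x ^+ n.
  by have := subrX1 x n => E; rewrite -[RHS]opprB E; ring.
by rewrite lerBlDr lerDl exprn_ge0.
Qed.

Definition hump t := t / (1 + t) ^+ 2.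

Lemma hump_le t : 0 <= t -> hump t <= t.
Proof.
by move=> t0; rewrite ler_pdivrMr ?exprn_gt0 ?ltr_wpDr// ler_peMr// exprn_ege1// lerDl.
Qed.

Lemma hump_le_inv t : 0 < t -> hump t <= t^-1.
Proof.
move=> t0; rewrite ler_pdivrMr ?exprn_gt0 ?addr_gt0// ler_pdivlMl//.
by rewrite -expr2 lerXn2r// ?nnegrE ?addr_ge0 ?(ltW t0)// lerDr.
Qed.

(** Makes the sum over geometric scales telescope along t / (1 + t), which stays between 0 and 1;
    hence a bound free of the number of scales. *)
Lemma hump_telescope x q : 0 <= x -> 0 < q -> q <= 1 / 2 ->
  hump x <= 2 * (x / q / (1 + x / q) - x / (1 + x)).
Proof.
move=> x0 q0 q2; set y := x / q.
have xy : 2 * x <= y.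
  rewrite /y ler_pdivlMr//; have := ler_wpM2l x0 q2; lra.
have y0 : 0 <= y by rewrite (le_trans _ xy)// mulr_ge0.
have y1 : 1 + y != 0 by rewrite gt_eqF// ltr_wpDr.
have x1 : 1 + x != 0 by rewrite gt_eqF// ltr_wpDr.
rewrite -subr_ge0.
have -> : 2 * (y / (1 + y) - x / (1 + x)) - hump x =
   (2 * (y - x) * (1 + x) - x * (1 + y)) / ((1 + y) * (1 + x) ^+ 2).
  by rewrite /hump; field; rewrite x1 y1.
have h : 0 <= (y - 2 * x) * (2 + x) by rewrite mulr_ge0 ?subr_ge0 ?addr_ge0.
rewrite divr_ge0//; first by move: x0 h; clearbody y; lra.
by rewrite mulr_ge0 ?sqr_ge0 ?addr_ge0.
Qed.

Lemma sum_hump_le t q N : 0 <= t -> 0 < q -> q <= 1 / 2 ->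
  \sum_(i < N) hump (t / q ^+ i.+1) <= 2.
Proof.
move=> t0 q0 q2; pose g (i : nat) := t / q ^+ i.+1 / (1 + t / q ^+ i.+1).
have gi i : 0 <= t / q ^+ i by rewrite divr_ge0// exprn_ge0// ltW.
have g01 i : 0 <= g i <= 1.
  rewrite /g divr_ge0 ?addr_ge0//= ler_pdivrMr ?ltr_wpDr// mul1r lerDr.
  exact: ler01.
suff : \sum_(i < N) hump (t / q ^+ i.+1) <= 2 * (g N - g 0%N).
  by have := g01 N; have := g01 0%N; move=> /andP[? ?] /andP[? ?]; lra.
elim: N => [|N IHN]; first by rewrite big_ord0 subrr mulr0.
rewrite big_ord_recr/= (le_trans (lerD IHN (hump_telescope (gi N.+1) q0 q2)))//.
have -> : t / q ^+ N.+1 / q = t / q ^+ N.+2.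
  by rewrite [q ^+ N.+2]exprSr invfM mulrA.
by rewrite -mulrDr ler_wpM2l// /g; lra.
Qed.

End Hump.

Section Bump.
Context (R : realType).
Implicit Types (z v : R[i]) (a C : R) (n : nat).

Definition bump n a z : R[i] := let s := cayley ((a^-1)%:C * (1 - z)) in
  n%:R * s ^+ n * (1 - s ^+ 2) ^+ 2.

Lemma half_plane_neq0 v : 0 <= complex.Re v -> 1 + v != 0.
Proof.
move=> v0; apply/eqP => E; have := sqr_rnorm1D v; rewrite E rnorm0 expr0n/=.
by have := sqr_ge0 (rnorm v); lra.
Qed.

Lemma cayley_le1 v : 0 <= complex.Re v -> rnorm (cayley v) <= 1.
Proof.
move=> v0; have v1 := half_plane_neq0 v0; have := Re_cayley v1.
have : 0 < rnorm (1 + v) ^+ 2 by rewrite exprn_gt0// lt_def rnorm_eq0 v1 rnorm_ge0.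
rewrite -(ler_pXn2r (n := 2)) ?nnegrE ?rnorm_ge0// expr1n.
move: (rnorm (cayley v) ^+ 2) (rnorm (1 + v) ^+ 2) => x y; nra.
Qed.

(** On the half-plane |1 + v|^2 >= 1 + |v|^2 >= (1 + |v|)^2 / 2. *)
Lemma onem_sqr_cayley_le v : 0 <= complex.Re v ->
  rnorm (1 - cayley v ^+ 2) <= 8 * hump (rnorm v).
Proof.
move=> v0; have v1 := half_plane_neq0 v0.
rewrite onem_sqr_cayley// rnormf_div rnormM rnormX rnorm_nat /hump.
have t0 := rnorm_ge0 v.
have N0 : 0 < rnorm (1 + v) ^+ 2 by rewrite exprn_gt0// lt_def rnorm_eq0 v1 rnorm_ge0.
have t1 : 0 < (1 + rnorm v) ^+ 2 by rewrite exprn_gt0// ltr_wpDr.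
rewrite ler_pdivrMr//; move: N0 t1; have := sqr_rnorm1D v.
move: (rnorm (1 + v) ^+ 2) (rnorm v) t0 => y t t0 yE y0 t1.
have -> : 8 * (t / (1 + t) ^+ 2) * y = 8 * t * y / (1 + t) ^+ 2 by ring.
rewrite ler_pdivlMr//.
have : t * ((1 + t) ^+ 2) <= t * (2 * y).
  by rewrite ler_wpM2l// yE; have := sqr_ge0 (1 - t); lra.
by move: ((1 + t) ^+ 2) => u; lra.
Qed.

(** In a sector 4 |v| / |1 + v|^2 <= C (1 - |s|^2), and 1 - |s|^2 <= 2 (1 - |s|). *)
Lemma onem_sqr_cayley_sector v C : 0 <= complex.Re v -> rnorm v <= C * complex.Re v ->
  0 <= C -> rnorm (1 - cayley v ^+ 2) <= 2 * C * (1 - rnorm (cayley v)).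
Proof.
move=> v0 vC C0; have v1 := half_plane_neq0 v0.
have s1 := cayley_le1 v0; have s0 := rnorm_ge0 (cayley v).
have N0 : 0 < rnorm (1 + v) ^+ 2 by rewrite exprn_gt0// lt_def rnorm_eq0 v1 rnorm_ge0.
have E := Re_cayley v1.
rewrite onem_sqr_cayley// rnormf_div rnormM rnormX rnorm_nat.
rewrite ler_pdivrMr// (@le_trans _ _ (C * (4 * complex.Re v)))//; first by lra.
rewrite E (mulrC 2) -!mulrA ler_wpM2l// mulrA ler_wpM2r ?(ltW N0)//.
by move: s0 s1; move: (rnorm (cayley v)) => s; nra.
Qed.

(** A crude bound, growing with [n], for the interaction between different scales: one factor 1 -
    s^2 is at most 2, the other gives the decay. *)
Lemma bump_half_plane n a z : 0 < a -> 0 <= complex.Re (1 - z) ->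
  rnorm (bump n a z) <= 16 * n%:R * hump (rnorm (1 - z) / a).
Proof.
move=> a0 z0; rewrite /bump; set v := _ * (1 - z).
have Rv : complex.Re v = a^-1 * complex.Re (1 - z).
  by rewrite /v; case: (1 - z) => x y /=; ring.
have v0 : 0 <= complex.Re v by rewrite Rv mulr_ge0 ?invr_ge0 ?(ltW a0).
have nv : rnorm v = rnorm (1 - z) / a.
  by rewrite /v rnormM rnorm_real ger0_norm ?invr_ge0 ?(ltW a0)// mulrC.
clearbody v; rewrite -nv !rnormM rnorm_nat !rnormX expr2.
have s1 := cayley_le1 v0; have s0 := rnorm_ge0 (cayley v).
have h := onem_sqr_cayley_le v0.
have h2 : rnorm (1 - cayley v ^+ 2) <= 2.
  apply: (le_trans (rnormD _ _)); rewrite rnorm1 rnormN rnormX.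
  by have : rnorm (cayley v) ^+ 2 <= 1 by [rewrite exprn_ile1]; lra.
have sn : rnorm (cayley v) ^+ n <= 1 by rewrite exprn_ile1.
have -> : 16 * n%:R * hump (rnorm v) = n%:R * 1 * (2 * (8 * hump (rnorm v))) by ring.
rewrite ler_pM ?mulr_ge0 ?ler0n ?exprn_ge0 ?rnorm_ge0//.
  by rewrite ler_wpM2l.
by rewrite ler_pM ?rnorm_ge0.
Qed.

(** One factor 1 - s^2 absorbs [n], since n |s|^n (1 - |s|) <= 1; the other supplies the decay away
    from scale [a]. *)
Lemma bump_sector n a z C : 0 < a -> 0 <= complex.Re (1 - z) -> 0 <= C ->
  rnorm (1 - z) <= C * complex.Re (1 - z) ->
  rnorm (bump n a z) <= 16 * C * hump (rnorm (1 - z) / a).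
Proof.
move=> a0 z0 C0 zC; rewrite /bump; set v := _ * (1 - z).
have Rv : complex.Re v = a^-1 * complex.Re (1 - z).
  by rewrite /v; case: (1 - z) => x y /=; ring.
have v0 : 0 <= complex.Re v by rewrite Rv mulr_ge0 ?invr_ge0 ?(ltW a0).
have nv : rnorm v = a^-1 * rnorm (1 - z).
  by rewrite /v rnormM rnorm_real ger0_norm ?invr_ge0 ?(ltW a0).
have vC : rnorm v <= C * complex.Re v.
  by rewrite Rv nv mulrCA ler_wpM2l ?invr_ge0 ?(ltW a0).
clearbody v; rewrite [_ / a]mulrC -nv !rnormM rnorm_nat !rnormX expr2.
have s1 := cayley_le1 v0; have s0 := rnorm_ge0 (cayley v).
have h := onem_sqr_cayley_le v0; have h2 := onem_sqr_cayley_sector v0 vC C0.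
have -> : 16 * C * hump (rnorm v) = (2 * C) * (8 * hump (rnorm v)) by ring.
rewrite mulrA ler_pM ?mulr_ge0 ?ler0n ?exprn_ge0 ?rnorm_ge0//.
apply: (@le_trans _ _ (n%:R * rnorm (cayley v) ^+ n * (2 * C * (1 - rnorm (cayley v))))).
  by rewrite ler_wpM2l// mulr_ge0 ?ler0n ?exprn_ge0.
by rewrite mulrCA ler_piMr ?mulr_ge0// exprn_onem_le.
Qed.

Lemma bump_node n a z : a != 0 -> 1 + z != 0 ->
  bump n a (node a z) = n%:R * z ^+ n * (1 - z ^+ 2) ^+ 2.
Proof.
move=> a0 z0; rewrite /bump onem_node mulrA -rmorphM mulVf// rmorph1 mul1r.
by rewrite cayleyK.
Qed.

Lemma bump_approximable n a : 0 < a -> poly_approximable 1 (bump n a).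
Proof.
move=> a0; have a1 : 1 < rnorm (a + 1)%:C.
  by rewrite rnorm_real gtr0_norm ?addr_gt0// ltrDr.
have pole z : rnorm z <= 1 -> (a + 1)%:C - z != 0.
  by move=> z1; rewrite subr_eq0; apply: contraTneq z1 => <-; rewrite -ltNge.
have sa : poly_approximable 1 (fun z => cayley ((a^-1)%:C * (1 - z))).
  (* The transform equals (a - 1 + z) / (a + 1 - z), with its only pole outside the closed disc. *)
  have := poly_approximableM (@poly_approximable_horner _ 1 ((a - 1)%:C%:P + 'X))
    (poly_approximable_pole ler01 a1).
  apply: poly_approximable_ext => z z1; rewrite hornerD hornerC hornerX.
  have aC : a%:C != 0 by rewrite (inj_eq (@complexI R) _ 0) gt_eqF.
  have := pole z z1; rewrite rmorphD rmorphB rmorph1 /cayley fmorphV => pz.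
  by field; rewrite addrA aC pz.
have := poly_approximableM (poly_approximableM (poly_approximable_cst 1 n%:R)
  (poly_approximableX n sa)) (poly_approximableX 2 (poly_approximableD
  (poly_approximable_cst 1 1) (poly_approximableM (poly_approximable_cst 1 (- 1))
  (poly_approximableX 2 sa)))).
by apply: poly_approximable_ext => z _; rewrite mulN1r.
Qed.

End Bump.

Lemma sum_cst_exp2 (S : nzRingType) (c : S) n : \sum_(j < 2 ^ n) c = 2 ^+ n * c.
Proof. by rewrite sumr_const card_ord -[c *+ _]mulr_natl natrX. Qed.

Section TestFunction.
Context (R : realType) (rho kappa q : R).
Hypotheses (rho34 : 3 / 4 <= rho) (rho1 : rho < 1) (kappaE : kappa = (1 - rho) / 2).
Hypotheses (q0 : 0 < q) (qk : q <= kappa ^+ 3 / 2).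
Context (w : R[i]) (n : nat) (w_prim : (n + 5).-primitive_root w).
Hypothesis qn : 48 * n%:R * 4 ^+ n * q <= 1.

Definition test_function (z : R[i]) : R[i] := \sum_(i < 2 ^ n) bump n (scale q i) z.

Let q2 : q <= 1 / 2.
Proof. by have := q_le1 rho34 rho1 kappaE qk; lra. Qed.

Lemma test_function_approximable : poly_approximable 1 test_function.
Proof.
by apply: poly_approximable_sum => i; apply: bump_approximable; exact: scale_gt0.
Qed.

Lemma test_function_sector z C : 0 <= complex.Re (1 - z) -> 0 <= C ->
  rnorm (1 - z) <= C * complex.Re (1 - z) -> rnorm (test_function z) <= 32 * C.
Proof.
move=> z0 C0 zC; apply: (le_trans (rnorm_sum _ _ _)).
apply: (@le_trans _ _ (\sum_(i < 2 ^ n) 16 * C * hump (rnorm (1 - z) / q ^+ i.+1))).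
  by apply: ler_sum => i _; apply: bump_sector => //; exact: scale_gt0.
rewrite -mulr_sumr; have := sum_hump_le (2 ^ n) (rnorm_ge0 (1 - z)) q0 q2.
have C16 : 0 <= 16 * C by rewrite mulr_ge0.
by move=> /(ler_wpM2l C16); lra.
Qed.

(** Nodes of scale j lie at distance between a_j / 3 and 3 a_j from 1. Seen from scale i, that
    distance or its inverse is at most 3 q, and [hump] is small at both ends. *)
Lemma bump_cross i j z : i != j -> rnorm z = 2^-1 ->
  rnorm (bump n (scale q i) (node (scale q j) z)) <= 48 * n%:R * q.
Proof.
move=> ij z2; have [si sj] := (scale_gt0 q0 i, scale_gt0 q0 j).
have z2' : rnorm z <= 2^-1 by rewrite z2.
have half1 : 2^-1 < 1 :> R by lra.
have u3 : rnorm (cayley z) <= 3.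
  by apply: (le_trans (cayley_le z2' half1)); rewrite ler_pdivrMr; lra.
have u3' : 1 / 3 <= rnorm (cayley z).
  by apply: le_trans (cayley_ge z2' half1); rewrite ler_pdivlMr; lra.
have Ru : 0 <= complex.Re (cayley z).
  by apply: le_trans (Re_cayley_ge z2' half1); lra.
have Rz : complex.Re (1 - node (scale q j) z) = scale q j * complex.Re (cayley z).
  by rewrite onem_node; case: (cayley z) => x y /=; ring.
apply: (le_trans (bump_half_plane n si _)).
  by rewrite Rz mulr_ge0 ?(ltW sj).
rewrite onem_node rnormM rnorm_real gtr0_norm//.
have -> : 48 * n%:R * q = 16 * n%:R * (3 * q) by ring.
rewrite ler_wpM2l ?mulr_ge0 ?ler0n//.
have u0 : 0 < rnorm (cayley z) by lra.
have t0 : 0 < scale q j * rnorm (cayley z) / scale q i by rewrite !(mulr_gt0, invr_gt0).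
have [ij'|ji|/eqP] := ltngtP i j; last by rewrite (negPf ij).
  apply: (le_trans (hump_le (ltW t0))); rewrite ler_pdivrMr//.
  have s := scale_ratio_le rho34 rho1 kappaE q0 qk ij'.
  apply: (@le_trans _ _ (q * scale q i * 3)); last by lra.
  by rewrite ler_pM ?rnorm_ge0 ?(ltW sj).
apply: (le_trans (hump_le_inv t0)); rewrite invf_div ler_pdivrMr ?mulr_gt0//.
have s := scale_ratio_le rho34 rho1 kappaE q0 qk ji.
apply: (le_trans s).
have := ler_wpM2l (mulr_ge0 (ltW q0) (ltW sj)) u3'.
by rewrite mulrA; lra.
Qed.

(** The polynomial has degree at most n + 4, so roots of unity of order n + 5 read off its n-th
    coefficient without aliasing. *)
Lemma taylor_bump_node :
  taylor w (n + 5) n (fun z => n%:R * z ^+ n * (1 - z ^+ 2) ^+ 2) = n%:R.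
Proof.
pose p : {poly R[i]} := n%:R *: ('X^n * (1 - 2%:P * 'X^2 + 'X^4)).
have -> : taylor w (n + 5) n (fun z => n%:R * z ^+ n * (1 - z ^+ 2) ^+ 2) =
    taylor w (n + 5) n (fun z => p.[z]).
  apply: taylor_ext => // z _.
  rewrite /p hornerZ hornerM hornerXn !hornerD hornerN hornerM !hornerXn !hornerC; ring.
have szp : (size p <= n + 5)%N.
  apply: (leq_trans (size_scale_leq _ _)).
  rewrite mulrC (leq_trans (size_polyMleq _ _))// size_polyXn.
  have : (size (1 - 2%:P * 'X^2 + 'X^4 : {poly R[i]})%R <= 5)%N.
    rewrite (leq_trans (size_polyD _ _))// geq_max size_polyXn leqnn andbT.
    rewrite (leq_trans (size_polyD _ _))// geq_max size_poly1/= size_polyN.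
    by rewrite mul_polyC (leq_trans (size_scale_leq _ _))// size_polyXn.
  by move=> h; rewrite addnS/= addnC leq_add2l.
have pn : p`_n = n%:R.
  rewrite /p coefZ coefXnM ltnn subnn !coefE/= mulr0 subr0 addr0 mulr1.
  by [].
rewrite /taylor root_average_horner//.
have nm : (n < n + 5)%N by rewrite addnS ltnS leq_addr.
have w_eq (j : 'I_(size p)) : (w ^+ j == w ^+ n) = (j == n :> nat).
  rewrite (eq_prim_root_expr w_prim) (modn_small nm).
  by rewrite (modn_small (leq_trans (ltn_ord j) szp)).
have -> : \sum_(j < size p | w ^+ j == w ^+ n) p`_j * 2^-1 ^+ j = p`_n * 2^-1 ^+ n.
  (* The first case is the degenerate n = 0, where [p] is 0. *)
  have [pn0|np] := leqP (size p) n.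
    rewrite (nth_default _ pn0) mul0r big1// => j.
    by rewrite w_eq ltn_eqF// (leq_trans (ltn_ord j)).
  rewrite (bigD1 (Ordinal np))//= big1 ?addr0// => j /andP[].
  by rewrite w_eq -(inj_eq val_inj)/= => ->.
by rewrite pn mulrCA exprVn mulfV ?mulr1// expf_neq0// pnatr_eq0.
Qed.

Lemma multiscale_test_function (P : {poly R[i]}) :
  (forall z, rnorm z <= 1 -> rnorm (test_function z - P.[z]) <= 2 ^- n) ->
  n%:R - 2 <= rnorm (multiscale q w (n + 5) n (P, [::])).
Proof.
move=> PQ.
have N0 : 0 < 2 ^+ n :> R by rewrite exprn_gt0.
suff : rnorm (n%:R - multiscale q w (n + 5) n (P, [::])) <= 2.
  have := rnorm_subr_ge (n%:R : R[i]) (multiscale q w (n + 5) n (P, [::])).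
  by rewrite rnorm_nat; lra.
have -> : n%:R - multiscale q w (n + 5) n (P, [::]) = (2 ^+ n)^-1 *
    \sum_(j < 2 ^ n) taylor w (n + 5) n (fun z => bump n (scale q j) (node (scale q j) z)
      - P.[node (scale q j) z]).
  have N0C : 2 ^+ n != 0 :> R[i] by rewrite expf_neq0// pnatr_eq0.
  apply: (mulfI N0C); rewrite mulVKf// mulrBr /multiscale mulVKf//.
  rewrite -sum_cst_exp2 -sumrB; apply: eq_bigr => j _; rewrite taylorB; congr (_ - _).
    rewrite -taylor_bump_node; apply: taylor_ext => // z z2.
    have z1 : 1 + z != 0 by apply: onep_neq0; rewrite z2; lra.
    by rewrite bump_node// gt_eqF// scale_gt0.
  by apply: taylor_ext => // z _; rewrite /pole_product/= big_nil mulr1.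
rewrite rnormM rnormV rnormX rnorm_nat ler_pdivrMl//.
apply: (le_trans (rnorm_sum _ _ _)).
rewrite -sum_cst_exp2; apply: ler_sum => j _.
(* One [2 ^- n] pays for replacing the test function by [P], the other for all cross terms; together
   they offset the factor [2 ^+ n] of [taylor]. *)
apply: (@le_trans _ _ (2 ^+ n * (2 * 2 ^- n))); last first.
  by rewrite mulrCA mulfV ?mulr1// gt_eqF.
apply: taylor_le => // z z2; set x := node _ z.
have x1 : rnorm x <= 1.
  apply/ltW/(node_half_lt1 rho34 rho1 kappaE) => //; first exact: scale_gt0.
  exact: (scale_le rho34 rho1 kappaE).
have -> : bump n (scale q j) x - P.[x] = test_function x - P.[x] -
    \sum_(i < 2 ^ n | i != j) bump n (scale q i) x.
  by rewrite /test_function (bigD1 j)//=; ring.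
apply: (le_trans (rnormD _ _)); rewrite rnormN mulr_natl mulr2n lerD ?PQ//.
apply: (le_trans (rnorm_sum _ _ _)).
apply: (@le_trans _ _ (\sum_(i < 2 ^ n) 48 * n%:R * q)).
  rewrite [leLHS]big_mkcond/=; apply: ler_sum => i _; case: ifP => ij.
    exact: bump_cross.
  by rewrite !mulr_ge0 ?ler0n ?(ltW q0).
rewrite sum_cst_exp2 -[2 ^- n]mul1r ler_pdivlMr//.
have -> : 2 ^+ n * (48 * n%:R * q) * 2 ^+ n = 48 * n%:R * 4 ^+ n * q :> R.
  have -> : 4 = 2 * 2 :> R by ring.
  by rewrite exprMn; ring.
exact: qn.
Qed.

End TestFunction.

(** * Stolz domains and the lower bound *)

Section Stolz.
Context (R : realType).

Lemma conv_complex (l : {i01 R}) (x y : Rcomplex R) :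
  conv l (x : convex_lmodType (Rcomplex R)) y =
  ((l%:num)%:C * x + (1 - l%:num)%:C * y)%R :> R[i].
Proof.
rewrite [LHS]/(l%:num *: x + (1 - l%:num) *: y).
case: x y => [a b] [c d]; congr (_ +i* _); by rewrite !mul0r ?subr0 ?addr0.
Qed.

Lemma sin_lt1 (g : R) : 0 < g -> g < pi / 2 -> sin g < 1.
Proof.
move=> g0 g2; have pi0 := pi_gt0 R; rewrite -sin_pihalf ltr_sin// in_itv/=; lra.
Qed.

(** The unit disc intersected with the cone |Im z| <= t (1 - Re z) is convex and contains 1. It
    contains the disc of radius sin g because there |Im z| <= 1 = t (1 - sin g). *)
Lemma stolz_domain_sector (g : R) : 0 < g -> g < pi / 2 ->
  exists2 C, 0 <= C & forall z, stolz_domain g z ->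
    [/\ rnorm z <= 1, 0 <= complex.Re (1 - z) & rnorm (1 - z) <= C * complex.Re (1 - z)].
Proof.
move=> g0 g2; have s1 := sin_lt1 g0 g2; pose t := (1 - sin g)^-1.
have t0 : 0 < t by rewrite invr_gt0 subr_gt0.
exists (1 + t) => [|z /interior_subset zhull]; first by rewrite addr_ge0// ltW.
pose S := [set z : Rcomplex R |
  rnorm (z : R[i]) <= 1 /\ `|complex.Im z| <= t * (1 - complex.Re z)].
have [z1 zt] : S z.
  apply: (zhull S); split.
    move=> x y l; rewrite !inE => -[x1 xt] [y1 yt]; rewrite /S/= conv_complex.
    have l0 : 0 <= l%:num by [].
    have l1 : 0 <= 1 - l%:num by rewrite subr_ge0.
    split.
      rewrite (le_trans (rnormD _ _))// !rnormM !rnorm_real !ger0_norm//.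
      have := ler_wpM2l l0 x1; have := ler_wpM2l l1 y1; lra.
    have -> : complex.Im ((l%:num)%:C * x + (1 - l%:num)%:C * y : R[i]) =
        l%:num * complex.Im x + (1 - l%:num) * complex.Im y.
      by case: (x) (y) => [a b] [c d] /=; ring.
    have -> : complex.Re ((l%:num)%:C * x + (1 - l%:num)%:C * y : R[i]) =
        l%:num * complex.Re x + (1 - l%:num) * complex.Re y.
      by case: (x) (y) => [a b] [c d] /=; ring.
    rewrite (le_trans (ler_normD _ _))// !normrM !(ger0_norm l0, ger0_norm l1).
    have := ler_wpM2l l0 xt; have := ler_wpM2l l1 yt; lra.
  move=> x [->|]; rewrite /S/=.
    by rewrite rnorm1 normr0 subrr mulr0.
  rewrite /disc/= => xs; split; first by rewrite ltW// (lt_trans xs).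
  apply: (@le_trans _ _ 1); first by rewrite (le_trans (abs_Im_le _))// ltW// (lt_trans xs).
  rewrite /t ler_pdivlMl ?subr_gt0// mulr1 lerD2l lerN2.
  by rewrite (le_trans (ler_norm _))// (le_trans (abs_Re_le _))// ltW.
have R1 : complex.Re (1 - z) = 1 - complex.Re z by case: (z).
have I1 : complex.Im (1 - z) = - complex.Im z by case: (z) => a b /=; ring.
have Rz : 0 <= 1 - complex.Re z.
  by rewrite subr_ge0 (le_trans (ler_norm _))// (le_trans (abs_Re_le _)).
rewrite R1; split=> //; rewrite (le_trans (rnorm_le_ReIm _))// R1 I1 normrN mulrDl mul1r.
by rewrite ger0_norm// lerD2l.
Qed.

End Stolz.

Section LowerBound.
Context (R : realType).

Lemma bernoulli_half n : (0 < n)%N -> 2^-1 <= (1 - (2 * n%:R)^-1) ^+ n :> R.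
Proof.
move=> n0; have n1 : 1 <= n%:R :> R by rewrite ler1n.
set x := (2 * n%:R)^-1.
have x0 : 0 <= x by rewrite invr_ge0 mulr_ge0.
have x1 : x <= 1 by rewrite invf_le1; lra.
have bern k : 1 - k%:R * x <= (1 - x) ^+ k.
  elim: k => [|k IHk]; first by rewrite mul0r subr0 expr0.
  rewrite exprS; have x1' : 0 <= 1 - x by rewrite subr_ge0.
  apply: le_trans (ler_wpM2l x1' IHk).
  have := mulr_ge0 (mulr_ge0 (ler0n R k) x0) x0; rewrite -natr1.
  by move: (k%:R) => y; lra.
apply: le_trans (bern n).
by rewrite /x invfM mulrCA mulfV ?gt_eqF ?ltr0n//; lra.
Qed.

Lemma mulX_opnorm_lower (n : nat) : (2 <= n)%N ->
  exists P : {poly R[i]}, n%:R - 2 <= 7 * opnorm (poly_op P (@mulX R)) /\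
    forall z C, rnorm z <= 1 -> 0 <= complex.Re (1 - z) -> 0 <= C ->
      rnorm (1 - z) <= C * complex.Re (1 - z) -> rnorm P.[z] <= 32 * C + 1.
Proof.
move=> n2; have n0 : (0 < n)%N by rewrite ltnW.
have nR : 2 <= n%:R :> R by rewrite ler_nat.
(* Bernoulli's inequality gives rho^n >= 1/2, and n >= 2 gives rho >= 3/4. *)
pose rho : R := 1 - (2 * n%:R)^-1; pose kappa := (1 - rho) / 2.
have kn : (2 * n%:R)^-1 <= 1 / 4 :> R by rewrite div1r lef_pV2 ?posrE; lra.
have kn0 : 0 < (2 * n%:R)^-1 :> R by rewrite invr_gt0; lra.
have rho34 : 3 / 4 <= rho by rewrite /rho; lra.
have rho1 : rho < 1 by rewrite /rho; lra.
have kappa0 : 0 < kappa by rewrite /kappa; lra.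
have kappa1 : kappa <= 1 by rewrite /kappa; lra.
pose D : R := 48 * n%:R * 4 ^+ n.
have D1 : 1 <= D.
  have : 1 <= 4 ^+ n :> R by rewrite exprn_ege1// ler1n.
  have : 1 <= 48 * n%:R :> R by lra.
  by move=> h h'; rewrite -[1]mulr1 ler_pM.
have D0 : 0 < D by rewrite (lt_le_trans ltr01).
(* Small enough for the nodes to stay in the disc and, through [D], for the cross terms to be
   negligible. *)
pose q := kappa ^+ 3 / 2 / D.
have k3 : 0 < kappa ^+ 3 / 2 by rewrite divr_gt0// exprn_gt0.
have k31 : kappa ^+ 3 / 2 <= 1.
  by have : kappa ^+ 3 <= 1 by [rewrite exprn_ile1// ltW]; lra.
have q0 : 0 < q by rewrite divr_gt0.
have qk : q <= kappa ^+ 3 / 2 by rewrite ler_pdivrMr// ler_peMr// ltW.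
have qn : 48 * n%:R * 4 ^+ n * q <= 1 by rewrite -/D mulrC divfK// gt_eqF.
have [w wP] : exists w : R[i], (n + 5).-primitive_root w.
  by apply: complex_prim_root_exists; rewrite addnS.
have nm : (n < n + 5)%N by rewrite addnS ltnS leq_addr.
have rho_n : 2^-1 <= rho ^+ n by exact: bernoulli_half.
have N0 : 0 < 2 ^- n :> R by rewrite invr_gt0 exprn_gt0.
have [P PQ] := test_function_approximable q0 n N0.
have QP := multiscale_test_function rho34 rho1 erefl q0 qk wP qn PQ.
exists P; split.
  apply: (le_trans QP).
  pose phi : functional R := Annih (multiscale_mem rho34 rho1 erefl q0 qk wP nm rho_n).
  apply: (@le_mulX_opnorm R P phi) => // f L.
  exact: (multiscale_le rho34 rho1 erefl q0 qk wP nm rho_n).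
move=> z C z1 Rz C0 zC.
rewrite -[P.[z]](subrK (test_function q n z)) addrC (le_trans (rnormD _ _))//.
rewrite lerD ?(test_function_sector rho34 rho1 erefl q0 qk)//.
rewrite rnormB (le_trans (PQ z z1))// invf_le1 ?exprn_gt0//.
by rewrite exprn_ege1// ler1n.
Qed.

End LowerBound.

Theorem theorem3p2 (R : realType) :
  exists (X : completeNormedModType R[i]) (T : {linear X -> X}),
    [/\ ritt T,
        polynomially_bounded T &
        forall gamma : R, 0 < gamma -> gamma < pi / 2 ->
          ~ bounded_Hinfty_calculus gamma T].
Proof.
exists (functional R), (@mulX R); split.
- exact: mulX_ritt.
- exact: mulX_polynomially_bounded.
move=> g g0 g2 [K K0 calc].
have [C C0 CP] := stolz_domain_sector g0 g2.
pose B := 7 * (K * (32 * C + 1)).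
have B0 : 0 <= B by rewrite !mulr_ge0// addr_ge0// mulr_ge0.
have [n Bn] : exists n : nat, B < n%:R.
  by exists (Num.bound B); have := archi_boundP B0.
(* The shift by 2 cancels the loss in the lower bound, leaving n <= B against B < n. *)
have [P [Pn PC]] := @mulX_opnorm_lower R n.+2 isT.
have : opnorm (poly_op P (@mulX R)) <= K * (32 * C + 1).
  apply: (le_trans (calc P)); rewrite ler_wpM2l//.
  (* An empty domain would have [sup] equal to 0, so the bound holds without showing that the domain
     has a point. *)
  have [->|/set0P S0] := eqVneq [set rnorm P.[z] | z in stolz_domain g] set0.
    by rewrite sup0 addr_ge0// mulr_ge0.
  apply: ge_sup => // _ [z /CP[z1 Rz zC] <-].
  exact: PC.
move: Pn Bn; rewrite /B -addn2 natrD => *; lra.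
Qed.
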